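(* Let $\pi, \tau \in \mathfrak{S}_m$ be non-overlapping, standard permutations. If $\pi \sim \tau$ (that is, $\pi$ and $\tau$ are c-Wilf equivalent), then $(\pi_1, \pi_m) = (\tau_1, \tau_m)$.
   Context: $\mathfrak{S}_m$ is the set of permutations of $\{1,\dots,m\}$, written in one-line notation $\pi = \pi_1 \pi_2 \cdots \pi_m$. The standardization of a sequence of $k$ distinct positive integers is the sequence obtained by replacing its $i$th smallest entry by $i$, for $1 \le i \le k$. Given $\pi \in \mathfrak{S}_m$ and $\sigma \in \mathfrak{S}_n$, an occurrence of $\pi$ in $\sigma$ as a consecutive pattern is a subsequence of consecutive entries $\sigma_i \sigma_{i+1} \cdots \sigma_{i+m-1}$ of $\sigma$ whose standardization is $\pi$; $\sigma$ avoids $\pi$ (as a consecutive pattern) if it has no occurrence of $\pi$ as a consecutive pattern. Permutations $\pi, \tau \in \mathfrak{S}_m$ are c-Wilf equivalent, written $\pi \sim \tau$, if for all $n$ the number of permutations in $\mathfrak{S}_n$ that avoid $\pi$ as a consecutive pattern equals the number that avoid $\tau$ as a consecutive pattern. A permutation $\pi \in \mathfrak{S}_m$ is standard if $\pi_1 < \pi_m$ and $\pi_1 + \pi_m \le m+1$. A permutation $\pi \in \mathfrak{S}_m$ is non-overlapping if for every $i$ with $2 \le i \le m-1$ the sequences $\pi_1 \cdots \pi_i$ and $\pi_{m-i+1} \cdots \pi_m$ have different standardizations. *)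

(* Defs.v *)
From mathcomp Require Import all_boot all_fingroup.

Set Implicit Arguments.
Unset Strict Implicit.
Unset Printing Implicit Defensive.

(* A permutation in 'S_m acts on {0, ..., m-1}; [oneline p] is the word
   p_1 p_2 ... p_m on the letters 1, ..., m. *)
Definition oneline (m : nat) (p : 'S_m) : seq nat :=
  [seq (nat_of_ord (p i)).+1 | i <- enum 'I_m].

(* [entry p k] is p_k, with k counted from 1; it is meaningful only for
   1 <= k <= m. *)
Definition entry (m : nat) (p : 'S_m) (k : nat) : nat :=
  nth 0 (oneline p) k.-1.

(* Only applied to sequences of distinct integers: the entry x is replaced by
   its 1-based position in the sorted sequence. *)
Definition standardization (s : seq nat) : seq nat :=
  [seq (index x (sort leq s)).+1 | x <- s].

(* The occurrence of p in s that starts right after the first i entries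
   of s. *)
Definition occurs_at (m n : nat) (p : 'S_m) (s : 'S_n) (i : nat) : bool :=
  (i + m <= n) && (standardization (take m (drop i (oneline s))) == oneline p).

Definition avoids (m n : nat) (p : 'S_m) (s : 'S_n) : bool :=
  ~~ [exists i : 'I_n.+1, occurs_at p s i].

Definition cWilf_equivalent (m : nat) (p t : 'S_m) : Prop :=
  forall n : nat, #|[set s : 'S_n | avoids p s]| = #|[set s : 'S_n | avoids t s]|.

Definition standard (m : nat) (p : 'S_m) : bool :=
  (entry p 1 < entry p m) && (entry p 1 + entry p m <= m + 1).

Definition non_overlapping (m : nat) (p : 'S_m) : Prop :=
  forall i : nat, 2 <= i <= m - 1 ->
    standardization (take i (oneline p)) <>
    standardization (drop (m - i) (oneline p)).

(* Main.v *)
Require Import Defs.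
From mathcomp Require Import all_boot all_fingroup.
From mathcomp Require Import ssralg ssrnum ssrint order zify ring.

Set Implicit Arguments.
Unset Strict Implicit.
Unset Printing Implicit Defensive.

(** Only occurrences in words matter.  Let [N] be an alphabet size, and count
    words of length n over the letters 0, ..., N-1 instead of permutations: a
    word with distinct letters is a permutation spread over an increasing choice
    of letters, and words with a repeated letter are O(N^(n-1)).  So c-Wilf
    equivalent patterns are avoided by the same number of words up to O(N^(n-1)).

    Inclusion-exclusion over the set S of marked positions turns this into a
    statement on the words in which the pattern occurs at every position of S.
    If S leaves a place where the word can be cut, the count is a product; if two
    marked windows overlap in two letters or more, it is 0 because the pattern is
    non-overlapping.  Exactly one S of each length escapes both: windows that are
    chained, each sharing one letter with the next.  By induction on the length
    this one has the same count for both patterns too, up to O(N^(n-1))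
    ([marked_words_same_density]).

    Let the pattern start with a+1, end with a+b+2, and have c letters above its
    last one.  A chain of k windows is then determined, up to the number of ways
    to fill in the other letters, by the shared letters x_0 < x_1 < ... < x_k, and
    the count is the sum over all such sequences of the product of
    C(x_(i-1), a) C(x_i - x_(i-1) - 1, b) C(N - 1 - x_i, c)
    ([marked_words_chain]).  It remains to recover a, b and c from the leading
    order of these sums for all k.

    Put d = b+1, and f(z) = z^(a/d) (1-z)^(c/d) with integral W over [0,1].  After
    normalization the k-th sum is, up to a subexponential factor,
    G^(kd) / (kd)! with G^d = W^d / (a! c!).  For the upper bound
    ([total_walks_le]) the weight at a step from x to y is at most the product of
    the values of f at any d points between x and y, so that the sum is at most an
    elementary symmetric function of values of f, hence at most a power of their
    sum over a factorial.  For the lower bound ([total_walks_ge]) the interval is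
    cut into many blocks on which the weights are bounded below by constants.
    Multiplying by s^(kd) and summing over k gives growth exp(s G) up to a
    polynomial factor, so d is determined ([growth_order]), and then G
    ([growth_le]).

    With a + c fixed and d >= 2, G^d is strictly increasing as a and c move
    towards each other ([rate_lt]).  Being standard means a <= c, so that a is
    determined.  The inequality follows from the log-convexity of W and its
    functional equations under shifts of a and c by d, which reduce the comparison
    of two neighbouring values to a comparison at infinity.  For d = 1 the rate G
    does not depend on a, and the chain of two windows decides instead: its leading
    coefficient is C(2a+1, a) C(2c+1, c), up to a constant ([two_windows_lt]). *)

(** * Words over a finite alphabet *)

Fixpoint words (N n : nat) : seq (seq nat) :=
  if n is n'.+1 then [seq x :: w | x <- iota 0 N, w <- words N n'] else [:: [::]].

Lemma mem_words N n w :
  (w \in words N n) = (size w == n) && all (fun x => x < N) w.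
Proof.
elim: n w => [|n IHn] w /=; first by case: w.
apply/allpairsP/idP => [[[x v] /= [hx hv ->]]|].
  by move: hx hv; rewrite mem_iota IHn /= eqSS add0n => -> /andP[-> ->].
case: w => [|x v] //=; rewrite eqSS => /andP[hs /andP[hx ha]].
by exists (x, v); rewrite mem_iota /= add0n IHn hs ha.
Qed.

Lemma uniq_words N n : uniq (words N n).
Proof.
elim: n => [|n IHn] //=; rewrite allpairs_uniq ?iota_uniq //.
by move=> [x v] [y w] _ _ /= [-> ->].
Qed.

Section WordSums.
Variables (R : Type) (idx : R) (op : Monoid.com_law idx) (N : nat).

Lemma big_words0 (F : seq nat -> R) : \big[op/idx]_(w <- words N 0) F w = F [::].
Proof. by rewrite big_seq1. Qed.

Lemma big_wordsS n (F : seq nat -> R) :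
  \big[op/idx]_(w <- words N n.+1) F w =
  \big[op/idx]_(x < N) \big[op/idx]_(w <- words N n) F (val x :: w).
Proof.
rewrite -(big_mkord xpredT (fun x => \big[op/idx]_(w <- words N n) F (x :: w))).
by rewrite /= big_allpairs_dep /index_iota subn0.
Qed.

Lemma big_words_cat a b (F : seq nat -> R) :
  \big[op/idx]_(w <- words N (a + b)) F w =
  \big[op/idx]_(u <- words N a) \big[op/idx]_(v <- words N b) F (u ++ v).
Proof.
elim: a F => [|a IHa] F; first by rewrite big_words0.
by rewrite addSn !big_wordsS; apply: eq_bigr => x _; rewrite IHa.
Qed.

End WordSums.

Lemma size_words N n : size (words N n) = N ^ n.
Proof. by elim: n => [|n IHn] //=; rewrite size_allpairs size_iota IHn expnS. Qed.

(** * Standardization and spreading a permutation over chosen letters *)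

(** Counting smaller entries makes standardization visibly depend on nothing but
    the relative order of the entries. *)
Lemma index_sort (s : seq nat) x : x \in s ->
  index x (sort leq s) = count (fun y => y < x) s.
Proof.
move=> xs; rewrite -(count_sort leq).
have: sorted leq (sort leq s) by apply: sort_sorted; exact: leq_total.
have: x \in sort leq s by rewrite mem_sort.
elim: (sort leq s) => [|z t IHt] //=; rewrite inE => hx hz.
have hzt: all (fun y => z <= y) t by apply: order_path_min hz; exact: leq_trans.
case: (eqVneq z x) hx => [zx|zx] /= hx.
  rewrite zx ltnn; apply/esym/eqP; rewrite add0n -leqn0 leqNgt -has_count.
  apply/hasPn => y /(allP hzt); rewrite -zx; lia.
rewrite IHt ?(path_sorted hz) //; have := allP hzt _ hx; lia.
Qed.

Lemma standardizationE s :
  standardization s = [seq (count (fun y => y < x) s).+1 | x <- s].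
Proof. by apply/eq_in_map => x xs; rewrite index_sort. Qed.

Lemma standardization_map (g : nat -> nat) s :
  {in s &, forall x y, (g x < g y) = (x < y)} ->
  standardization [seq g x | x <- s] = standardization s.
Proof.
move=> hg; rewrite !standardizationE -map_comp; apply/eq_in_map => x xs /=.
by rewrite count_map; congr _.+1; apply: eq_in_count => y ys /=; exact: hg.
Qed.

Lemma uniq_standardization s : uniq (standardization s) -> uniq s.
Proof. by rewrite standardizationE; exact: map_uniq. Qed.

Lemma size_oneline m (p : 'S_m) : size (oneline p) = m.
Proof. by rewrite size_map -cardE card_ord. Qed.

Lemma uniq_oneline m (p : 'S_m) : uniq (oneline p).
Proof.
rewrite map_inj_uniq ?enum_uniq // => i j [] /val_inj; exact: perm_inj.
Qed.

Lemma nth_oneline m (p : 'S_m) (i : 'I_m) : nth 0 (oneline p) i = (p i).+1.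
Proof. by rewrite (nth_map i) ?nth_ord_enum // size_enum_ord. Qed.

(** For increasing b this is the arrangement of the letters of b that is order
    isomorphic to p; every word that standardizes to p has this form. *)
Definition spread (m : nat) (p : 'S_m) (b : seq nat) : seq nat :=
  [seq nth 0 b k.-1 | k <- oneline p].

Lemma size_spread m (p : 'S_m) b : size (spread p b) = m.
Proof. by rewrite size_map size_oneline. Qed.

Lemma spreadE m (p : 'S_m) b : spread p b = [seq nth 0 b (p i) | i <- enum 'I_m].
Proof. by rewrite /spread -map_comp. Qed.

Lemma oneline_bounds m (p : 'S_m) k : k \in oneline p -> 0 < k <= m.
Proof. by move=> /mapP[i _ ->] /=. Qed.

Lemma spread_mono m (b : seq nat) : sorted ltn b -> size b = m ->
  {in (fun k => 0 < k <= m) &, forall x y, (nth 0 b x.-1 < nth 0 b y.-1) = (x < y)}.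
Proof.
move=> sb hb x y hx hy; rewrite !unfold_in in hx hy.
have hlt i j : i < j -> j < m -> nth 0 b i < nth 0 b j.
  move=> ij jm; apply: (@sorted_ltn_nth _ ltn ltn_trans) => //; rewrite inE hb; lia.
case: (ltngtP x y) => h.
- by apply: hlt; lia.
- by apply/negbTE; rewrite -leqNgt ltnW //; apply: hlt; lia.
- by rewrite h ltnn.
Qed.

Lemma standardization_oneline m (p : 'S_m) : standardization (oneline p) = oneline p.
Proof.
rewrite standardizationE -[RHS]map_id; apply/eq_in_map => _ /mapP[i _ ->].
congr _.+1; rewrite count_map -sum1_count big_enum_cond /=.
rewrite -[RHS](card_ord (p i)) -sum1_card (big_ord_widen m (fun=> 1) (ltnW (ltn_ord _))).
by rewrite [RHS](reindex_inj (@perm_inj _ p)).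
Qed.

Lemma standardization_spread m (p : 'S_m) b : sorted ltn b -> size b = m ->
  standardization (spread p b) = oneline p.
Proof.
move=> sb hb; rewrite -[RHS]standardization_oneline; apply: standardization_map.
by move=> x y /oneline_bounds hx /oneline_bounds hy; exact: spread_mono sb hb _ _ hx hy.
Qed.

Lemma sorted_sort_uniq (u : seq nat) : uniq u -> sorted ltn (sort leq u).
Proof.
by move=> uu; rewrite ltn_sorted_uniq_leq sort_uniq uu sort_sorted //; exact: leq_total.
Qed.

Lemma spread_sort m (p : 'S_m) u :
  standardization u = oneline p -> u = spread p (sort leq u).
Proof.
move=> hu; rewrite /spread -hu /standardization -map_comp -[LHS]map_id.
by apply/eq_in_map => x xs /=; rewrite nth_index // mem_sort.
Qed.

Lemma sorted_sort_std m (p : 'S_m) u :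
  standardization u = oneline p -> sorted ltn (sort leq u).
Proof.
by move=> hu; apply/sorted_sort_uniq/uniq_standardization; rewrite hu uniq_oneline.
Qed.

Lemma size_std u : size (standardization u) = size u.
Proof. by rewrite size_map. Qed.

Lemma perm_spread m (p : 'S_m) b : size b = m -> perm_eq (spread p b) b.
Proof.
move=> hb; rewrite spreadE (map_comp (nth 0 b) (fun i => val (p i))).
have -> : perm_eq [seq nth 0 b i | i <- [seq val (p i) | i <- enum 'I_m]] b =
          perm_eq [seq nth 0 b i | i <- [seq val (p i) | i <- enum 'I_m]]
                  [seq nth 0 b i | i <- [seq val i | i <- enum 'I_m]].
  by congr perm_eq; rewrite val_enum_ord -hb -/(mkseq _ _) mkseq_nth.
apply/perm_map; rewrite (map_comp val p); apply: perm_map.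
apply: uniq_perm; [|exact: enum_uniq|].
  by rewrite map_inj_uniq; [exact: enum_uniq|exact: perm_inj].
move=> i; rewrite mem_enum; apply/mapP; exists (p^-1%g i); rewrite ?mem_enum //.
by rewrite permKV.
Qed.

Lemma sort_spread m (p : 'S_m) b : sorted ltn b -> size b = m ->
  sort leq (spread p b) = b.
Proof.
move=> sb hb; apply: (sorted_eq leq_trans anti_leq).
- by apply: sort_sorted; exact: leq_total.
- exact: (sub_sorted ltnW).
- by rewrite perm_sort perm_spread.
Qed.

Lemma spread_words N m (p : 'S_m) b : b \in words N m -> spread p b \in words N m.
Proof.
rewrite !mem_words size_spread eqxx => /andP[/eqP hb ha].
by rewrite (perm_all _ (perm_spread p hb)).
Qed.

Lemma sort_words N m w : w \in words N m -> sort leq w \in words N m.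
Proof. by rewrite !mem_words size_sort all_sort. Qed.

Lemma size_words_in N m w : w \in words N m -> size w = m.
Proof. by rewrite mem_words => /andP[/eqP]. Qed.

Lemma uniq_spread n (w : seq nat) : uniq w -> size w = n ->
  exists s : 'S_n, w = spread s (sort leq w).
Proof.
move=> uw hw; have hf (i : 'I_n) : index (nth 0 w i) (sort leq w) < n.
  by rewrite -{2}hw -(size_sort leq) index_mem mem_sort mem_nth ?hw.
have finj : injective (fun i => Ordinal (hf i)).
  move=> i j [] /(congr1 (nth 0 (sort leq w))).
  rewrite !nth_index ?mem_sort ?mem_nth ?hw // => /eqP.
  by rewrite nth_uniq ?hw // => /eqP/val_inj.
exists (perm finj); rewrite spreadE; apply: (@eq_from_nth _ 0).
  by rewrite size_map size_enum_ord.
move=> i; rewrite hw => hi; rewrite (nth_map (Ordinal hi)) ?size_enum_ord //.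
rewrite (_ : nth _ _ i = Ordinal hi) ?permE /= ?nth_index ?mem_sort ?mem_nth ?hw //.
by apply: val_inj; rewrite /= nth_enum_ord.
Qed.

Lemma oneline_inj n : injective (@oneline n).
Proof. by move=> s s' h; apply/permP => i; apply: val_inj; apply: succn_inj;
  rewrite -!nth_oneline h. Qed.

Section Reindexing.
Variables (R : Type) (idx : R) (op : Monoid.com_law idx) (N : nat).

(** A word is recovered from its pattern and its set of letters: sums over the words
    of pattern p are sums over increasing words. *)
Lemma big_words_std m (p : 'S_m) (F : seq nat -> R) :
  \big[op/idx]_(w <- words N m | standardization w == oneline p) F w =
  \big[op/idx]_(b <- words N m | sorted ltn b) F (spread p b).
Proof.
rewrite -big_filter -[RHS]big_filter -(big_map (spread p) xpredT).
apply: perm_big; apply: uniq_perm.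
- by rewrite filter_uniq ?uniq_words.
- rewrite map_inj_in_uniq ?filter_uniq ?uniq_words // => b c.
  rewrite !mem_filter => /andP[sb /size_words_in hb] /andP[sc /size_words_in hc] h.
  by rewrite -(sort_spread p sb hb) h sort_spread.
move=> w; rewrite mem_filter; apply/andP/mapP => [[/eqP hw ww]|[b]].
  exists (sort leq w); last exact: spread_sort.
  by rewrite mem_filter sort_words // (sorted_sort_std hw).
rewrite mem_filter => /andP[sb wb] ->; split; last exact: spread_words.
by rewrite standardization_spread // (size_words_in wb).
Qed.

Lemma big_words_uniq n (F : seq nat -> R) :
  \big[op/idx]_(w <- words N n | uniq w) F w =
  \big[op/idx]_(b <- words N n | sorted ltn b) \big[op/idx]_(s : 'S_n) F (spread s b).
Proof.
rewrite -big_filter -[RHS]big_filter.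
transitivity (\big[op/idx]_(w <- [seq spread s b | b <- [seq b <- words N n | sorted ltn b],
    s <- enum 'S_n]) F w); last first.
  by rewrite big_allpairs_dep; apply: eq_bigr => b _; rewrite big_enum.
apply: perm_big; apply: uniq_perm.
- by rewrite filter_uniq ?uniq_words.
- apply: allpairs_uniq; [by rewrite filter_uniq ?uniq_words|exact: enum_uniq|].
  move=> _ _ /allpairsP[[b s] /= [hb _ ->]] /allpairsP[[c t] /= [hc _ ->]] /= h.
  move: hb hc; rewrite !mem_filter => /andP[sb /size_words_in hb] /andP[sc /size_words_in hc].
  have bc : b = c by rewrite -(sort_spread s sb hb) h sort_spread.
  congr (_, _) => //; apply: oneline_inj.
  by rewrite -(standardization_spread s sb hb) h standardization_spread.
move=> w; rewrite mem_filter; apply/andP/allpairsP => [[uw ww]|[[b s] /= []]].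
  have [s hs] := uniq_spread uw (size_words_in ww).
  by exists (sort leq w, s); rewrite mem_filter sort_words ?sorted_sort_uniq // mem_enum.
rewrite mem_filter => /andP[sb wb] _ ->; split; last exact: spread_words.
rewrite (perm_uniq (perm_spread _ (size_words_in wb))).
by move: sb; rewrite ltn_sorted_uniq_leq => /andP[].
Qed.

End Reindexing.

(** * Counting increasing words *)

Lemma hockey_stick N p : \sum_(x < N) 'C(x, p) = 'C(N, p.+1).
Proof. by elim: N => [|N IHN]; rewrite ?big_ord0 // big_ord_recr /= IHN binS addnC. Qed.

(** Both sides count the subsets of size p+q+1 of an N-element chain, on the left by
    their element of rank p+1. *)
Lemma sum_bin_bin N p q : \sum_(x < N) 'C(x, p) * 'C(N.-1 - x, q) = 'C(N, p + q.+1).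
Proof.
elim: N q => [|N IHN] q; first by rewrite big_ord0 addnS.
case: q => [|q].
  by under eq_bigr => x _ do rewrite bin0 muln1; rewrite hockey_stick addn1.
rewrite big_ord_recr /= subnn bin0n muln0 addn0.
rewrite [RHS](_ : _ = 'C(N, p + q.+2) + 'C(N, p + q.+1)); last by rewrite addnS binS.
rewrite -!IHN -big_split /=; apply: eq_bigr => x _.
rewrite -mulnDr; congr (_ * _); rewrite -binS; congr 'C(_, _); have := ltn_ord x; lia.
Qed.

Lemma sum_interval_bin N lo hi n : hi <= N ->
  \sum_(z < N | lo <= z < hi) 'C(hi - z.+1, n) = 'C(hi - lo, n.+1).
Proof.
move=> hN; rewrite -hockey_stick.
rewrite -(big_mkord (fun z => lo <= z < hi) (fun z => 'C(hi - z.+1, n))).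
have [h|h] := leqP hi lo.
  rewrite (_ : hi - lo = 0); last lia.
  by rewrite big_ord0 big1 // => z; lia.
rewrite (big_cat_nat (n := lo)) //=; last lia.
rewrite big_nat_cond big_pred0 ?add0n; last by move=> z; lia.
rewrite (big_cat_nat (n := hi)) //=; last lia.
rewrite addnC big_nat_cond big_pred0 ?add0n; last by move=> z; lia.
rewrite big_nat_cond (eq_bigl (fun z => lo <= z < hi)); last by move=> z /=; lia.
rewrite -big_nat -(big_mkord xpredT (fun x => 'C(x, n))) big_nat_rev /= -{1}[lo]add0n.
rewrite big_addn; rewrite big_nat [RHS]big_nat.
by apply: eq_bigr => i hi'; congr 'C(_, _); lia.
Qed.

Lemma count_increasing N lo hi n : hi <= N ->
  \sum_(w <- words N n | sorted ltn w && all (fun z => lo <= z < hi) w) 1 = 'C(hi - lo, n).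
Proof.
move=> hN; elim: n lo => [|n IHn] lo.
  by rewrite big_mkcond big_words0 bin0.
rewrite big_mkcond big_wordsS /= -(@sum_interval_bin N lo hi n hN) [RHS]big_mkcond.
apply: eq_bigr => z _.
case: (boolP (lo <= z < hi)) => hz; last first.
  by rewrite big1 // => w _; rewrite ?(negPf hz) /= andbF.
rewrite -IHn [RHS]big_mkcond; apply: eq_bigr => w _ /=.
congr (if _ then _ else _).
rewrite path_sortedE; last exact: ltn_trans.
case: (sorted ltn w); rewrite ?andbF // andbT; apply/andP/allP => [[/allP h /allP h']|h].
  by move=> y yw; have := h y yw; have := h' y yw => /=; lia.
split; first by apply/allP => y /h; lia.
by apply/allP => y /h; lia.
Qed.

(** * Chains of windows that share one letter *)
Definition occurs_word m (p : 'S_m) (u : seq nat) i :=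
  (i + m <= size u) && (standardization (take m (drop i u)) == oneline p).

(** All positions up to the size are tested, so that a mark on a window that does
    not fit makes the word fail. *)
Definition marked m (p : 'S_m) (S : pred nat) (u : seq nat) :=
  all (fun i => S i ==> occurs_word p u i) (iota 0 (size u).+1).

Definition marked_words m (p : 'S_m) (S : pred nat) n N :=
  \sum_(w <- words N n | marked p S w) 1.

Section Chains.
Variables (a b c : nat).

(** The number of words of length m and pattern p over N letters that start with x
    and end with y: choose the a letters below x, the b letters between x and y, and
    the c letters above y. *)
Definition step N x y :=
  if x < y then 'C(x, a) * 'C(y - x.+1, b) * 'C(N - y.+1, c) else 0.

Fixpoint walks N k x :=
  if k is k'.+1 then \sum_(y < N) step N x y * walks N k' y else 1.

Definition total_walks N k := \sum_(x < N) walks N k x.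

Variables (m : nat) (p : 'S_m).
Hypothesis hm : m = a + (b + c.+1).+1.
Hypothesis head_p : head 0 (oneline p) = a.+1.
Hypothesis last_p : last 0 (oneline p) = (a + b.+1).+1.

Lemma m_gt0 : 0 < m. Proof. by rewrite hm addnS. Qed.

Lemma head_spread b' : head 0 (spread p b') = nth 0 b' a.
Proof.
rewrite /spread; have := size_oneline p; have := head_p.
by case: (oneline p) => [_|k s /= -> //]; rewrite hm addnS.
Qed.

Lemma last_spread b' : last 0 (spread p b') = nth 0 b' (a + b.+1).
Proof.
rewrite /spread; have := size_oneline p; have := last_p.
case: (oneline p) => [_|k s /= h _]; first by rewrite hm addnS.
by rewrite /= (last_map (fun k => nth 0 b' k.-1)) h.
Qed.

Lemma sorted_cat3 (u v w : seq nat) x y N : all (fun z => z < N) w ->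
  sorted ltn (u ++ x :: v ++ y :: w) =
  [&& x < y, sorted ltn u && all (fun z => 0 <= z < x) u,
    sorted ltn v && all (fun z => x.+1 <= z < y) v &
    sorted ltn w && all (fun z => y.+1 <= z < N) w].
Proof.
move=> hw; rewrite !(sorted_pairwise ltn_trans).
rewrite pairwise_cat pairwise_cons pairwise_cat pairwise_cons allrel_consr allrel_consr.
rewrite all_cat /=.
apply/idP/idP.
  move=> /andP[/andP[ux _] /andP[-> /andP[/and3P[/allP xv -> _]]]].
  move=> /andP[/andP[/allP vy _] /and3P[-> /allP yw ->]]; rewrite ux /=.
  apply/andP; split; apply/allP => z hz; first by rewrite (xv _ hz) (vy _ hz).
  by rewrite (yw _ hz) (allP hw _ hz).
move=> /and4P[xy /andP[-> /allP ux] /andP[-> /allP hv] /andP[-> /allP yw]].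
rewrite xy /= !andbT; apply/and4P; split.
- apply/andP; split; first by apply/allP.
  apply/allrelP => z z' /ux zx; rewrite mem_cat inE /= => /orP[/hv|/orP[/eqP->|/yw]]; lia.
- by apply/andP; split; apply/allP => z; [move=> /hv|move=> /yw]; lia.
- apply/andP; split; first by apply/allP => z /hv; lia.
  by apply/allrelP => z z' /hv hz /yw hz' /=; lia.
- by apply/allP => z /yw; lia.
Qed.

Lemma nth_pivot1 (u s : seq nat) x : size u = a -> nth 0 (u ++ x :: s) a = x.
Proof. by move=> hu; rewrite nth_cat hu ltnn subnn. Qed.

Lemma nth_pivot2 (u v w : seq nat) x y : size u = a -> size v = b ->
  nth 0 (u ++ x :: v ++ y :: w) (a + b.+1) = y.
Proof.
move=> hu hv; rewrite nth_cat hu ltnNge leq_addr addKn /=.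
by rewrite nth_cat hv ltnn subnn.
Qed.

Lemma sum_increasing_words N (F : nat -> nat -> nat) :
  \sum_(w <- words N m | sorted ltn w) F (nth 0 w a) (nth 0 w (a + b.+1)) =
  \sum_(x < N) \sum_(y < N) step N x y * F x y.
Proof.
rewrite hm big_mkcond big_words_cat /=.
under eq_big_seq => u hu.
  rewrite big_wordsS.
  under eq_bigr => x _.
    rewrite big_words_cat.
    under eq_big_seq => v hv.
      rewrite big_wordsS.
      under eq_bigr => y _.
        under eq_big_seq => w hw.
          rewrite (@sorted_cat3 _ _ _ _ _ N); last by move: hw; rewrite mem_words => /andP[].
          rewrite (nth_pivot1 _ _ (size_words_in hu)).
          rewrite (nth_pivot2 _ _ _ (size_words_in hu) (size_words_in hv)).
          over.
        over.
      over.
    over.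
  over.
rewrite exchange_big /=; apply: eq_bigr => x _.
under eq_bigr => u _ do rewrite exchange_big /=.
rewrite exchange_big /=; apply: eq_bigr => y _.
rewrite /step; case: ifP => xy; last first.
  by rewrite mul0n big1 // => u _; rewrite big1 // => v _; rewrite big1.
have cx := count_increasing 0 a (ltnW (ltn_ord x)); rewrite subn0 in cx; rewrite -cx.
rewrite -(count_increasing x.+1 b (ltnW (ltn_ord y))) -(count_increasing y.+1 c (leqnn N)).
rewrite [in RHS]big_mkcond !big_distrl /=; apply: eq_bigr => u _.
case: ifP => hu; last by rewrite !mul0n big1 // => v _; rewrite big1.
rewrite mul1n [in RHS]big_mkcond !big_distrl /=; apply: eq_bigr => v _.
case: ifP => hv; last by rewrite !mul0n big1.
rewrite mul1n [in RHS]big_mkcond !big_distrl /=; apply: eq_bigr => w _.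
by case: ifP => hw; rewrite ?mul0n ?mul1n.
Qed.

(** Summing over the letters after the first one of a word of pattern p leaves a sum
    over its last letter: this glues windows along a common letter. *)
Lemma sum_words_from_letter N (G : nat -> nat) (x : 'I_N) :
  \sum_(w <- words N m.-1 | standardization (val x :: w) == oneline p) G (last (val x) w) =
  \sum_(y < N) step N x y * G y.
Proof.
have h := sum_increasing_words N (fun x' y => (x' == x) * G y).
rewrite [RHS](bigD1 x) //= [X in _ = _ + X]big1 ?addn0 in h; last first.
  by move=> x' /negPf nx; rewrite big1 // => y _; rewrite (inj_eq val_inj) nx muln0.
rewrite [RHS](eq_bigr (fun y : 'I_N => step N x y * G y)) in h; last first.
  by move=> y _; rewrite eqxx mul1n.
rewrite -h; under [RHS]eq_bigr => w _ do rewrite -head_spread -last_spread.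
rewrite -(big_words_std _ N p (fun w => (head 0 w == x) * G (last 0 w))).
rewrite (_ : words N m = words N m.-1.+1); last by rewrite prednK ?m_gt0.
rewrite [RHS]big_mkcond big_wordsS (bigD1 x) //= [X in _ = _ + X]big1 ?addn0.
  by rewrite [LHS]big_mkcond; apply: eq_bigr => w _; rewrite eqxx (mul1n (G _)).
by move=> x' /negPf nx; rewrite big1 // => w _; rewrite (inj_eq val_inj) nx if_same.
Qed.

(** The windows that start at multiples of m-1, read one after the other: x is the
    letter shared with the previous window. *)
Fixpoint linked k x (w : seq nat) :=
  if k is k'.+1 then
    (standardization (x :: take m.-1 w) == oneline p) &&
    linked k' (last x (take m.-1 w)) (drop m.-1 w)
  else true.

Definition chain_marks k : pred nat := fun i => (m.-1 %| i) && (i + m <= (k * m.-1).+1).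

Lemma marked_chain k x w : 1 < m -> size w = k * m.-1 ->
  marked p (chain_marks k) (x :: w) = linked k x w.
Proof.
move=> m1 hw.
have -> : marked p (chain_marks k) (x :: w) =
    all (fun j => standardization (take m (drop (j * m.-1) (x :: w))) == oneline p) (iota 0 k).
  apply/allP/allP => h i.
    rewrite mem_iota /= add0n => ik.
    have hi : i * m.-1 + m <= (k * m.-1).+1.
      have : i.+1 * m.-1 <= k * m.-1 by rewrite leq_mul2r ik orbT.
      rewrite mulSn; lia.
    have := h (i * m.-1); rewrite mem_iota /= /chain_marks dvdn_mull // hi /= /occurs_word /= hw hi.
    by apply; lia.
  rewrite mem_iota /= /chain_marks /occurs_word /= hw => hi; apply/implyP => /andP[/dvdnP[j hj] hj'].
  rewrite hj' /= hj; apply: h; rewrite mem_iota /= add0n; move: hj'; rewrite hj => hj'.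
  have : j * m.-1 < k * m.-1 by lia.
  by rewrite ltn_mul2r => /andP[].
elim: k x w hw => [|k IHk] x w hw //=.
have hsz : m.-1 <= size w by rewrite hw mulSn leq_addr.
rewrite (_ : take m (x :: w) = x :: take m.-1 w); last by rewrite -{1}(prednK m_gt0).
congr (_ && _).
rewrite -IHk; last by rewrite size_drop hw mulSn addKn.
rewrite -[1]/(1 + 0) iotaDl all_map; apply: eq_all => j /=.
rewrite mulSn addnC -drop_drop; congr (standardization (take _ (drop _ _)) == _).
have m2 : m.-1 = m.-2.+1 by lia.
have hs2 : size (take m.-1 w) = m.-1 by rewrite size_takel.
rewrite {1}m2 [LHS]/= (drop_nth 0); last by lia.
rewrite -m2; congr (_ :: _).
rewrite -nth_last hs2 (set_nth_default 0); last by rewrite hs2; lia.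
by rewrite nth_take //; lia.
Qed.

Lemma sum_linked N k (x : 'I_N) :
  \sum_(w <- words N (k * m.-1) | linked k x w) 1 = walks N k x.
Proof.
elim: k x => [|k IHk] x; first by rewrite big_mkcond mul0n big_words0.
rewrite mulSn big_mkcond big_words_cat.
under eq_big_seq => u hu.
  under eq_bigr => v _ do
    rewrite /= take_size_cat ?(size_words_in hu) // drop_size_cat ?(size_words_in hu) //.
  over.
rewrite /= -sum_words_from_letter [RHS]big_mkcond; apply: eq_big_seq => u hu.
case: ifP => hs; last by rewrite big1.
have hl : last (val x) u < N.
  have : all (fun z => z < N) (val x :: u).
    by move: hu; rewrite mem_words /= ltn_ord => /andP[].
  by move=> /allP; apply; exact: mem_last.
by rewrite -(IHk (Ordinal hl)) [RHS]big_mkcond.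
Qed.

Lemma marked_words_chain k N : 1 < m ->
  marked_words p (chain_marks k) (k * m.-1).+1 N = total_walks N k.
Proof.
move=> m1; rewrite /marked_words big_mkcond big_wordsS; apply: eq_bigr => x _.
rewrite -sum_linked [RHS]big_mkcond; apply: eq_big_seq => w hw.
by rewrite marked_chain // (size_words_in hw).
Qed.

End Chains.

Lemma std_window m (p : 'S_m) b k l : sorted ltn b -> size b = m ->
  standardization (take k (drop l (spread p b))) = standardization (take k (drop l (oneline p))).
Proof.
move=> sb hb; rewrite /spread -map_drop -map_take; apply: standardization_map.
have hin x : x \in take k (drop l (oneline p)) -> 0 < x <= m.
  by move=> /mem_take /mem_drop; exact: oneline_bounds.
by move=> x y /hin hx /hin hy; exact: spread_mono sb hb _ _ hx hy.
Qed.

Lemma std_window_std m (p : 'S_m) u k l : standardization u = oneline p ->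
  standardization (take k (drop l u)) = standardization (take k (drop l (oneline p))).
Proof.
move=> hu; rewrite {1}(spread_sort hu); apply: std_window.
  exact: sorted_sort_std hu.
by rewrite size_sort -size_std hu size_oneline.
Qed.

(** * Words and permutations *)

(** If the windows shared two letters or more, the common part would be both a prefix
    and a suffix of the pattern, up to standardization. *)
Lemma no_overlap m (p : 'S_m) u i j : non_overlapping p ->
  occurs_word p u i -> occurs_word p u j -> i < j -> i + m <= j.+1.
Proof.
move=> hp /andP[hi /eqP oi] /andP[hj /eqP oj] ij; rewrite leqNgt; apply/negP => hij.
pose l := m - (j - i).
apply: (hp l); first by rewrite /l; lia.
have := std_window_std l 0 oj; rewrite !drop0 => <-.
have := std_window_std l (m - l) oi.
rewrite (_ : take l (drop (m - l) (oneline p)) = drop (m - l) (oneline p)); last first.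
  by rewrite take_oversize // size_drop size_oneline /l; lia.
move=> <-; congr standardization.
have lm : l + (m - l) = m by rewrite /l; lia.
rewrite take_takel ?leq_subr // -[in take m (drop i u)]lm -take_drop take_takel // drop_drop.
by congr (take _ (drop _ _)); rewrite /l; lia.
Qed.

Definition avoiding_word m (p : 'S_m) u := ~~ has (occurs_word p u) (iota 0 (size u).+1).

Lemma avoiding_spread m n (p : 'S_m) (s : 'S_n) b : sorted ltn b -> size b = n ->
  avoiding_word p (spread s b) = avoids p s.
Proof.
move=> sb hb; congr (~~ _); rewrite size_spread.
have ho i : occurs_word p (spread s b) i = occurs_at p s i.
  by rewrite /occurs_word /occurs_at size_spread std_window.
apply/hasP/existsP => [[i]|[i hi]].
  by rewrite mem_iota add0n /= => hi; rewrite ho => hi'; exists (Ordinal hi).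
by exists (val i); rewrite ?ho // mem_iota /= add0n ltn_ord.
Qed.

(** A word with distinct letters is a permutation spread over its set of letters, and
    avoidance does not see the spreading. *)
Lemma sum_uniq_avoiding m (p : 'S_m) n N :
  \sum_(w <- words N n | uniq w) avoiding_word p w =
  'C(N, n) * #|[set s : 'S_n | avoids p s]|.
Proof.
have cN := count_increasing 0 n (leqnn N); rewrite subn0 in cN.
rewrite big_words_uniq -cN big_distrl /=.
rewrite big_mkcond [RHS]big_mkcond; apply: eq_big_seq => b wb.
have hb := size_words_in wb.
rewrite (_ : all _ b = true); last by move: wb; rewrite mem_words => /andP[].
rewrite andbT; case: ifP => // sb; rewrite mul1n -sum1_card [RHS]big_mkcond /=.
by apply: eq_bigr => s _; rewrite avoiding_spread // inE; case: (avoids _ _).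
Qed.

Lemma sum_uniq n N : \sum_(w <- words N n | uniq w) 1 = N ^_ n.
Proof.
have cN := count_increasing 0 n (leqnn N); rewrite subn0 in cN.
rewrite big_words_uniq -bin_ffact -cN big_distrl /=.
rewrite big_mkcond [RHS]big_mkcond; apply: eq_big_seq => b wb.
rewrite (_ : all _ b = true); last by move: wb; rewrite mem_words => /andP[].
rewrite andbT; case: ifP => // sb; rewrite mul1n sum1_card.
by rewrite -(card_Sn n); apply: eq_card => s; rewrite !inE.
Qed.

Lemma ffact_le_expn n k : n ^_ k <= n ^ k.
Proof.
elim: k => [|k IHk]; first by rewrite ffactn0.
by rewrite ffactnSr expnSr leq_mul // leq_subr.
Qed.

(** At most a fraction n^2/N of all words have a repeated letter. *)
Lemma expn_ffact N n : N ^ n * N <= N ^_ n * N + n * n * N ^ n.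
Proof.
elim: n => [|n IHn]; first by rewrite !expn0 ffactn0 leq_addr.
rewrite ffactnSr expnS.
have le := ffact_le_expn N n.
have : N * (N ^ n * N) <= N * (N ^_ n * N + n * n * N ^ n) by rewrite leq_mul2l IHn orbT.
have : N ^_ n * N <= N ^_ n * (N - n) + N ^_ n * n by rewrite -mulnDr leq_mul2l; lia.
nia.
Qed.

(** * Equivalent patterns have the same number of chains, to leading order *)

Section WindowsInWords.
Import Order.TTheory GRing.Theory Num.Theory.

(** This says f N = O(N^(n-1)); multiplying by N keeps the exponent a natural number,
    and for n = 0 the condition forces f to vanish at positive arguments. *)
Definition negligible n (f : nat -> int) :=
  exists C : nat, forall N, (`|f N| * N%:R <= C%:R * N%:R ^+ n)%R.

Section Negligible.
Local Open Scope ring_scope.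

Lemma negligible0 n f : (forall N, f N = 0) -> negligible n f.
Proof. by move=> h; exists 0%N => N; rewrite h normr0 !mul0r. Qed.

Lemma negligibleD n f g : negligible n f -> negligible n g ->
  negligible n (fun N => f N + g N).
Proof.
move=> [C hC] [D hD]; exists (C + D)%N => N.
rewrite natrD mulrDl (le_trans _ (lerD (hC N) (hD N))) // -mulrDl.
by rewrite ler_wpM2r ?ler_normD.
Qed.

Lemma negligibleM n f s : negligible n f -> (forall N, `|s N| <= 1) ->
  negligible n (fun N => s N * f N).
Proof.
move=> [C hC] hs; exists C => N; apply: le_trans (hC N).
by rewrite ler_wpM2r // normrM -[leRHS]mul1r ler_wpM2r.
Qed.

Lemma negligible_sum n (I : finType) (P : pred I) (F : I -> nat -> int) :
  (forall i, P i -> negligible n (F i)) -> negligible n (fun N => \sum_(i | P i) F i N).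
Proof.
move=> h; rewrite /negligible; suff : forall r : seq I, exists C : nat, forall N,
    (`|\sum_(i <- r | P i) F i N| * N%:R <= C%:R * N%:R ^+ n)%R by apply.
elim=> [|i r [C hC]]; first by exists 0%N => N; rewrite big_nil normr0 !mul0r.
case Pi : (P i); last by exists C => N; rewrite big_cons Pi.
have [D hD] := h i Pi; exists (D + C)%N => N; rewrite big_cons Pi.
rewrite natrD mulrDl (le_trans _ (lerD (hD N) (hC N))) // -mulrDl.
by rewrite ler_wpM2r ?ler_normD.
Qed.

End Negligible.

(** The marks of words of length n lie in {0, ..., n}, so a set of ordinals encodes
    them; [inord] is meaningful only there. *)
Definition mark n (J : {set 'I_n.+1}) : pred nat := fun i => inord i \in J.

Lemma marked_words_le m (p : 'S_m) S n N : marked_words p S n N <= N ^ n.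
Proof.
rewrite /marked_words -size_words -sum1_size [X in X <= _]big_mkcond.
by apply: leq_sum => w _; case: ifP.
Qed.

Definition avoiding_words m (p : 'S_m) n N := \sum_(w <- words N n) avoiding_word p w.

Lemma inclusion_exclusion m (p : 'S_m) n N :
  ((avoiding_words p n N)%:Z = \sum_(J : {set 'I_n.+1})
     (-1) ^+ #|J| * (marked_words p (mark J) n N)%:Z)%R.
Proof.
rewrite /avoiding_words -natz natr_sum.
under [RHS]eq_bigr => J _ do rewrite -natz natr_sum mulr_sumr big_mkcond /=.
rewrite [RHS]exchange_big /=; apply: eq_big_seq => w ww.
have -> : ((avoiding_word p w)%:R = \prod_(i < n.+1) (- (occurs_word p w i)%:R + 1) :> int)%R.
  rewrite /avoiding_word (size_words_in ww).
  case: (boolP (has _ _)) => [/hasP[i]|/hasPn h].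
    rewrite mem_iota /= add0n => hi oi.
    by rewrite (bigD1 (Ordinal hi)) //= oi addNr mul0r.
  rewrite big1 // => i _; rewrite (negPf (h _ _)) ?oppr0 ?add0r //.
  by rewrite mem_iota add0n ltn_ord.
rewrite bigA_distr; apply: eq_bigr => J _.
rewrite -big_mkcond /= prodrN.
case: ifP => [/allP h|/negbT/allPn[i]].
  congr (_ * _)%R; rewrite big1 // => i iJ; have := h i; rewrite mem_iota add0n (size_words_in ww) ltn_ord.
  by rewrite /mark inord_val iJ => /(_ isT) /= ->.
rewrite mem_iota add0n (size_words_in ww) /= => hi; rewrite negb_imply /mark => /andP[iJ oi].
by rewrite (bigD1 (inord i)) //= inordK // (negPf oi) mul0r mulr0.
Qed.

(** The words with distinct letters contribute the same number for p and t; the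
    others are too few to matter. *)
Lemma avoiding_words_negligible m (p t : 'S_m) n : cWilf_equivalent p t ->
  negligible n (fun N => (avoiding_words p n N)%:Z - (avoiding_words t n N)%:Z)%R.
Proof.
move=> hpt; exists (n * n) => N.
have hb (q : 'S_m) : exists2 r, avoiding_words q n N =
    'C(N, n) * #|[set s : 'S_n | avoids q s]| + r & r * N <= n * n * N ^ n.
  exists (\sum_(w <- words N n | ~~ uniq w) avoiding_word q w).
    by rewrite /avoiding_words (bigID uniq) /= sum_uniq_avoiding.
  apply: (@leq_trans ((N ^ n - N ^_ n) * N)); last first.
    by rewrite mulnBl; have := expn_ffact N n; lia.
  rewrite leq_mul2r; apply/orP; right.
  rewrite -sum_uniq -size_words -sum1_size (bigID uniq xpredT) /= addKn.
  by apply: leq_sum => w _; case: (avoiding_word _ _).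
have [r -> hr] := hb p; have [r' -> hr'] := hb t; rewrite hpt.
have -> : (`|('C(N, n) * #|[set s : 'S_n | avoids t s]| + r)%:Z -
    ('C(N, n) * #|[set s : 'S_n | avoids t s]| + r')%:Z| = `|r%:Z - r'%:Z| :> int)%R by lia.
suff : (`|r%:Z - r'%:Z| * N%:Z <= ((n * n)%N * N ^ n)%N%:Z)%R.
  by rewrite -!natz !natrM natrX natz.
nia.
Qed.

Lemma occurs_catl m (p : 'S_m) u v i : 0 < m -> i + m <= size u ->
  occurs_word p (u ++ v) i = occurs_word p u i.
Proof.
move=> m0 h; rewrite /occurs_word h size_cat (leq_trans h (leq_addr _ _)) /=.
congr (standardization _ == _); rewrite drop_cat ifT; last lia.
by rewrite takel_cat // size_drop; lia.
Qed.

Lemma occurs_catr m (p : 'S_m) u v i :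
  occurs_word p (u ++ v) (size u + i) = occurs_word p v i.
Proof.
rewrite /occurs_word size_cat -addnA leq_add2l; congr (_ && (standardization _ == _)).
by rewrite addnC -drop_drop drop_size_cat.
Qed.

(** Cutting after the first c letters damages no marked window. *)
Definition splits m (S : pred nat) n c :=
  all (fun i => S i ==> ((i + m <= c) || (c <= i))) (iota 0 n.+1).

Lemma marked_words_split m (p : 'S_m) S n c N : 0 < m -> c <= n -> splits m S n c ->
  marked_words p S n N = marked_words p (fun i => S i && (i + m <= c)) c N *
    marked_words p (fun i => S (c + i)) (n - c) N.
Proof.
move=> m0 cn /allP hS; rewrite /marked_words -{1}(subnKC cn).
rewrite big_mkcond big_words_cat [in RHS]big_mkcond big_distrl /=.
apply: eq_big_seq => u hu; rewrite [in RHS]big_mkcond big_distrr /=.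
apply: eq_big_seq => v hv; set L := marked p _ u; set R := marked p _ v.
suff -> : marked p S (u ++ v) = L && R by case: L; case: R.
have su := size_words_in hu; have sv := size_words_in hv.
rewrite /L /R /marked size_cat su sv (subnKC cn).
apply/allP/andP => [h|[/allP hL /allP hR] i].
  split; apply/allP => i; rewrite mem_iota add0n /= => hi; apply/implyP.
    move=> /andP[Si ic]; rewrite -(occurs_catl _ v) ?su //.
    by have := h i; rewrite mem_iota Si /=; apply; lia.
  move=> Si; rewrite -(occurs_catr _ u) su.
  by have := h (c + i); rewrite mem_iota Si /=; apply; lia.
move=> hi; apply/implyP => Si; have := hS i hi; rewrite Si /=.
move: hi; rewrite mem_iota add0n /= => hi.
case: (leqP (i + m) c) => /= ic.
  by move=> _; rewrite occurs_catl ?su //; have := hL i; rewrite mem_iota Si ic /=; apply; lia.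
move=> ci; have := hR (i - c); rewrite mem_iota (subnKC ci) Si /= -(occurs_catr _ u) su (subnKC ci).
by apply; lia.
Qed.

(** The marks that escape both reductions: no cut is possible, all marked windows
    fit, and any two of them share at most one letter. *)
Definition clustered m (S : pred nat) n := [&&
  all (fun c => ~~ splits m S n c) (iota 1 n.-1),
  all (fun i => S i ==> (i + m <= n)) (iota 0 n.+1) &
  all (fun i => all (fun j => [&& S i, S j & i < j] ==> (i + m <= j.+1)) (iota 0 n.+1))
    (iota 0 n.+1)].

(** Every cut must hit a marked window.  The cut after the first letter gives a window
    at 0; the cut at the end of a window must hit a later one, which can only start at
    the last letter of that window.  So all multiples of m-1 are marked, and any other
    mark would overlap too much with the multiple before it. *)
Lemma clustered_unique m S n i : 1 < m -> 1 < n -> clustered m S n -> i <= n ->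
  S i = (m.-1 %| i) && (i + m <= n).
Proof.
case: m => [//|q] m1 n1 /and3P[/allP hc /allP hf /allP ho].
have inI k : k <= n -> k \in iota 0 n.+1 by rewrite mem_iota.
have cut c : 0 < c < n -> exists k, [/\ k <= n, S k, k < c & c < k + q.+1].
  move=> hc'; have := hc c; rewrite mem_iota => /(_ ltac:(lia)) /allPn[k].
  by rewrite mem_iota negb_imply negb_or => hk /and3P[Sk h1 h2]; exists k; split=> //; lia.
have fit k : k <= n -> S k -> k + q.+1 <= n by move=> kn Sk; have := hf k (inI k kn); rewrite Sk.
have ov k l : k <= n -> l <= n -> S k -> S l -> k < l -> k + q.+1 <= l.+1.
  by move=> kn ln Sk Sl kl; have /allP/(_ l (inI l ln)) := ho k (inI k kn); rewrite Sk Sl kl.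
have mult j : j * q + q.+1 <= n -> S (j * q).
  elim: j => [|j IHj] hj.
    have [k [kn Sk k1 _]] := cut 1 ltac:(lia).
    have k0 : k = 0 by lia.
    by rewrite mul0n; move: Sk; rewrite k0.
  have hj' : j.+1 * q = j * q + q by rewrite mulSn addnC.
  rewrite hj' in hj *.
  have Sj : S (j * q) by apply: IHj; lia.
  have [k [kn Sk k1 k2]] := cut (j * q + q.+1) ltac:(lia).
  have jk : j * q < k by lia.
  have := ov (j * q) k ltac:(lia) kn Sj Sk jk => h.
  have -> : j * q + q = k by lia.
  by [].
rewrite [q.+1.-1]/= => hi; apply/idP/andP => [Si|[/dvdnP[j ->]]]; last exact: mult.
have fi := fit i hi Si; split=> //; rewrite /dvdn; apply/eqP.
have ei := divn_eq i q; have lt := ltn_pmod i (_ : 0 < q).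
have {}lt : i %% q < q by apply: lt; lia.
set d := i %/ q in ei; have Sq : S (d * q) by apply: mult; lia.
have [//|r0] := posnP (i %% q).
by have := ov (d * q) i ltac:(lia) hi Sq Si ltac:(lia); lia.
Qed.

Lemma eq_marked_words m (p : 'S_m) S T n N : (forall i, i <= n -> S i = T i) ->
  marked_words p S n N = marked_words p T n N.
Proof.
move=> h; rewrite /marked_words big_mkcond [RHS]big_mkcond; apply: eq_big_seq => w ww.
congr (if _ then _ else _); apply: eq_in_all => i.
by rewrite mem_iota add0n (size_words_in ww) /= => hi; rewrite h.
Qed.

Lemma marked_words0 m (p : 'S_m) (S : pred nat) n N :
  (forall w, w \in words N n -> ~~ marked p S w) -> marked_words p S n N = 0.
Proof.
by move=> h; rewrite /marked_words big_mkcond big1_seq // => w /andP[_ /h /negPf->].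
Qed.

Lemma marked_words_fit m (p : 'S_m) (S : pred nat) n N :
  ~~ all (fun i => S i ==> (i + m <= n)) (iota 0 n.+1) -> marked_words p S n N = 0.
Proof.
move=> /allPn[i]; rewrite mem_iota => hi; rewrite negb_imply => /andP[Si him].
apply: marked_words0 => w /size_words_in hw; apply/allPn; exists i; first by rewrite mem_iota hw.
by rewrite negb_imply Si /occurs_word hw (negPf him).
Qed.

Lemma marked_words_overlap m (p : 'S_m) (S : pred nat) n N : non_overlapping p ->
  ~~ all (fun i => all (fun j => [&& S i, S j & i < j] ==> (i + m <= j.+1)) (iota 0 n.+1))
    (iota 0 n.+1) -> marked_words p S n N = 0.
Proof.
move=> hp /allPn[i]; rewrite mem_iota => hi /allPn[j]; rewrite mem_iota => hj.
rewrite negb_imply => /andP[/and3P[Si Sj ij] him].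
apply: marked_words0 => w /size_words_in hw; apply/negP => /allP h.
have := h i; rewrite mem_iota hw Si /= => /(_ ltac:(lia)) oi.
have := h j; rewrite mem_iota hw Sj /= => /(_ ltac:(lia)) oj.
by move/negP: him; apply; exact: (no_overlap hp oi oj).
Qed.

Section Comparison.
Variables (m : nat) (p t : 'S_m).
Hypotheses (m1 : 1 < m) (hp : non_overlapping p) (ht : non_overlapping t).
Hypothesis hpt : cWilf_equivalent p t.

Definition same_density S n :=
  negligible n (fun N => (marked_words p S n N)%:Z - (marked_words t S n N)%:Z)%R.

(** With p1 p2 and t1 t2 the two products, p1 p2 - t1 t2 = (p1 - t1) p2 + t1 (p2 - t2). *)
Lemma same_density_split S n c : 0 < c < n -> splits m S n c ->
  (forall k T, k < n -> same_density T k) -> same_density S n.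
Proof.
move=> hc hS IH.
have [C hC] := IH c (fun i => S i && (i + m <= c)) ltac:(lia).
have [D hD] := IH (n - c) (fun i => S (c + i)) ltac:(lia).
exists (C + D) => N; move: (hC N) (hD N).
rewrite !(@marked_words_split _ _ S n c) //; try lia.
have := marked_words_le p (fun i => S (c + i)) (n - c) N.
have := marked_words_le t (fun i => S i && (i + m <= c)) c N.
set p1 := marked_words p _ c N; set p2 := marked_words p _ (n - c) N.
set t1 := marked_words t _ c N; set t2 := marked_words t _ (n - c) N => h1 h2 h3 h4.
have -> : (N%:R ^+ n = N%:R ^+ c * N%:R ^+ (n - c) :> int)%R by rewrite -exprD subnKC //; lia.
have -> : ((p1 * p2)%N%:Z - (t1 * t2)%N%:Z = (p1%:Z - t1%:Z) * p2%:Z + t1%:Z * (p2%:Z - t2%:Z))%R.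
  by rewrite !PoszM; ring.
apply: le_trans (ler_wpM2r (ler0n _ _) (ler_normD _ _)) _.
rewrite natrD mulrDl [leRHS]mulrDl; apply: lerD.
  rewrite normrM mulrAC mulrA; apply: ler_pM; rewrite ?mulr_ge0 //.
  by rewrite -natz normr_nat -natrX ler_nat.
rewrite normrM -mulrA [leRHS]mulrCA; apply: ler_pM; rewrite ?mulr_ge0 //.
by rewrite -natz normr_nat -natrX ler_nat.
Qed.

(** In the inclusion-exclusion formula for the difference of the numbers of avoiding
    words, all terms but at most one are negligible by induction, and so is the total;
    hence the remaining term is negligible. *)
Lemma marked_words_same_density n S : same_density S n.
Proof.
elim/ltn_ind: n S => n IH S.
have [n1|n1] := leqP n 1.
  (* such short words contain no window *)
  apply: negligible0 => N; case: (boolP (all (fun i => ~~ S i) (iota 0 n.+1))) => hS.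
    have e (q : 'S_m) : marked_words q S n N = marked_words q pred0 n N.
      by apply: eq_marked_words => i hi; apply/negbTE/(allP hS); rewrite mem_iota.
    have {}e (q : 'S_m) : marked_words q S n N = N ^ n.
      rewrite e -size_words -sum1_size /marked_words; apply: eq_bigl => w.
      by apply/allP.
    by rewrite !e subrr.
  rewrite !marked_words_fit //; apply/allPn; move/allPn: hS => [i hi /negPn Si];
    by exists i => //; rewrite Si /= -ltnNge (leq_ltn_trans n1) ?ltn_addl.
(* a cut gives a product; the other two failures leave no word at all *)
have nonclustered T : ~~ clustered m T n -> same_density T n.
  move=> /nandP[/allPn[c]|/nandP[hT|hT]].
  - rewrite mem_iota => /andP[c1 c2] /negPn hT; apply: (same_density_split _ hT) => //.
      by rewrite c1 (leq_trans c2) // add1n prednK // ltnW.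
    by move=> k T' kn; exact: IH.
  - by apply: negligible0 => N; rewrite !marked_words_fit.
  - by apply: negligible0 => N; rewrite !marked_words_overlap.
case: (boolP (clustered m S n)) => [cS|]; last exact: nonclustered.
(* the clustered set of marks is unique, so every other J is covered above *)
pose J0 : {set 'I_n.+1} := [set i : 'I_n.+1 | S i].
have markJ0 i : i <= n -> mark J0 i = S i by move=> hi; rewrite /mark inE inordK.
have cJ (J : {set 'I_n.+1}) : J != J0 -> ~~ clustered m (mark J) n.
  apply: contra => cJ; apply/eqP/setP => i; rewrite inE.
  have hi : i <= n by rewrite -ltnS.
  rewrite (clustered_unique m1 n1 cS hi) -(clustered_unique m1 n1 cJ hi) /mark.
  by rewrite inord_val.
have hsum : negligible n (fun N => \sum_(J : {set 'I_n.+1} | J != J0)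
    (-1) ^+ #|J| * ((marked_words p (mark J) n N)%:Z - (marked_words t (mark J) n N)%:Z))%R.
  apply: negligible_sum => J /cJ/nonclustered h; apply: negligibleM h _ => N.
  by rewrite normrX normrN1 expr1n.
have hsign (f : nat -> int) k : negligible n f -> negligible n (fun N => (-1) ^+ k * f N)%R.
  by move=> hf; apply: negligibleM => // N; rewrite normrX normrN1 expr1n.
(* total minus the other terms; the sign of the J0 term is then undone *)
have := negligibleD (avoiding_words_negligible n hpt) (hsign _ 1 hsum).
move=> /(hsign _ #|J0|) [C hC]; exists C => N; move: (hC N).
rewrite !inclusion_exclusion -sumrB.
rewrite (eq_bigr (fun J : {set 'I_n.+1} => (-1) ^+ #|J| *
  ((marked_words p (mark J) n N)%:Z - (marked_words t (mark J) n N)%:Z))%R); last first.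
  by move=> J _; rewrite mulrBr.
rewrite (bigD1 J0) //= expr1 mulN1r addrK mulrA -exprD addnn -signr_odd odd_double mul1r.
by rewrite !(eq_marked_words _ _ markJ0).
Qed.

End Comparison.

Lemma walks_asymptotics m (p t : 'S_m) (a b c a' b' c' : nat) k :
  non_overlapping p -> non_overlapping t -> cWilf_equivalent p t -> 1 < m ->
  m = a + (b + c.+1).+1 -> m = a' + (b' + c'.+1).+1 ->
  head 0 (oneline p) = a.+1 -> last 0 (oneline p) = (a + b.+1).+1 ->
  head 0 (oneline t) = a'.+1 -> last 0 (oneline t) = (a' + b'.+1).+1 ->
  exists C, forall N,
    total_walks a b c N k * N <= total_walks a' b' c' N k * N + C * N ^ (k * m.-1).+1.
Proof.
move=> hp ht hpt m1 hm hm' h1 h2 h3 h4.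
have [C hC] := marked_words_same_density m1 hp ht hpt (k * m.-1).+1 (chain_marks m k).
exists C => N; move: (hC N).
rewrite (marked_words_chain hm h1 h2) // (marked_words_chain hm' h3 h4) //.
rewrite -!natz -natrX !natz; nia.
Qed.

End WindowsInWords.

(** Here a, b and c are the numbers of letters below the first letter, between the two
    end letters, and above the last letter; standard means that a <= c. *)
Lemma standard_parameters m (p : 'S_m) : standard p -> exists a b c,
  [/\ m = a + (b + c.+1).+1, a <= c, 1 < m &
     [/\ head 0 (oneline p) = a.+1, last 0 (oneline p) = (a + b.+1).+1,
         entry p 1 = a.+1 & entry p m = (a + b.+1).+1]].
Proof.
rewrite /standard; have -> : entry p 1 = head 0 (oneline p) by rewrite /entry nth0.
have -> : entry p m = last 0 (oneline p) by rewrite /entry -nth_last size_oneline.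
have [m0|m0] := posnP m.
  by move: (size_oneline p); rewrite [RHS]m0 => /size0nil ->.
have hl : last 0 (oneline p) <= m.
  have : last 0 (oneline p) \in oneline p.
    by case: (oneline p) (size_oneline p) m0 => [/= <-//|x s _ _]; rewrite /= mem_last.
  by move=> /oneline_bounds/andP[].
have hh : 0 < head 0 (oneline p).
  have : head 0 (oneline p) \in oneline p.
    by case: (oneline p) (size_oneline p) m0 => [/= <-//|x s _ _]; rewrite mem_head.
  by move=> /oneline_bounds/andP[].
move: hl hh; set h := head _ _; set l := last _ _ => hl hh /andP[hlt hsum].
exists h.-1, (l - h).-1, (m - l); split; try lia.
by split; lia.
Qed.

(** * Upper bound for the number of walks *)

Section WalkBounds.
Import Order.TTheory GRing.Theory Num.Theory.
Section Backwards.
Variables (a b c : nat).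

(** Walks counted by their end point, whereas [walks] fixes the starting point; the
    bounds are proved by induction on the last step. *)
Fixpoint reach (N k y : nat) : nat :=
  if k is k'.+1 then \sum_(x < N) reach N k' x * step a b c N x y else 1.

Lemma reach_walks N j k :
  \sum_(x < N) reach N j x * walks a b c N k x = \sum_(x < N) reach N (j + k) x.
Proof.
elim: k j => [|k IHk] j; first by rewrite addn0; apply: eq_bigr => x _; rewrite muln1.
rewrite addnS -addSn -IHk /=; under eq_bigr => x _ do rewrite big_distrr /=.
rewrite exchange_big /=; apply: eq_bigr => y _; rewrite big_distrl /=.
by apply: eq_bigr => x _; rewrite mulnA.
Qed.

Lemma total_walksE N k : total_walks a b c N k = \sum_(y < N) reach N k y.
Proof. by rewrite -(add0n k) -reach_walks; apply: eq_bigr => x _; rewrite mul1n. Qed.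

Lemma reachS N k y : y < N -> reach N k.+1 y =
  'C(N - y.+1, c) * \sum_(x < y) reach N k x * 'C(x, a) * 'C(y - x.+1, b).
Proof.
move=> yN; rewrite [LHS]/= big_distrr /=.
rewrite [RHS](big_ord_widen_cond N xpredT (fun x =>
  'C(N - y.+1, c) * (reach N k x * 'C(x, a) * 'C(y - x.+1, b)))); last exact: ltnW.
rewrite [RHS]big_mkcond; apply: eq_bigr => x _ /=.
rewrite /step; case: ifP => _; rewrite ?muln0 //; ring.
Qed.

End Backwards.

Section UpperBound.
Local Open Scope ring_scope.
Variable R : realFieldType.
Implicit Types (f g h : nat -> R).

Definition psum h y : R := \sum_(x < y) h x.

Lemma psumS h y : psum h y.+1 = psum h y + h y.
Proof. by rewrite /psum big_ord_recr. Qed.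

Lemma iter_psum0 h k : iter k.+1 psum h 0 = 0.
Proof. by rewrite /= /psum big_ord0. Qed.

(** The binomial coefficient counts the ways to insert b intermediate points between
    x and y, so a step is the same as b+1 nested partial sums. *)
Lemma convolution_iter_psum h b y :
  \sum_(x < y) h x * 'C(y - x.+1, b)%:R = iter b.+1 psum h y.
Proof.
elim: b y => [|b IHb] y.
  by apply: eq_bigr => x _; rewrite bin0 mulr1.
elim: y => [|y IHy]; first by rewrite big_ord0 iter_psum0.
have -> : iter b.+2 psum h y.+1 = iter b.+2 psum h y + iter b.+1 psum h y by exact: psumS.
rewrite -IHy -IHb big_ord_recr /= subnn bin0n mulr0 addr0.
rewrite -big_split /=; apply: eq_bigr => x _; rewrite -mulrDr -natrD.
congr (_ * _%:R); rewrite subSS -binS; congr 'C(_, _); have := ltn_ord x; lia.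
Qed.

(** The n-th term of the exponential series. *)
Definition expterm n (x : R) : R := x ^+ n / n`!%:R.

Lemma expterm0 x : expterm 0 x = 1. Proof. by rewrite /expterm expr0 fact0 divr1. Qed.

Lemma expterm_ge0 n x : 0 <= x -> 0 <= expterm n x.
Proof. by move=> hx; rewrite divr_ge0 ?exprn_ge0 ?ler0n. Qed.

Lemma exprD_ge (s f : R) n : 0 <= s -> 0 <= f ->
  s ^+ n.+1 + n.+1%:R * f * s ^+ n <= (s + f) ^+ n.+1.
Proof.
move=> s0 f0; elim: n => [|n IHn]; first by rewrite !expr1 expr0 mulr1 mul1r.
rewrite [leRHS]exprS; apply: le_trans (ler_wpM2l (addr_ge0 s0 f0) IHn).
rewrite -subr_ge0.
have -> : (s + f) * (s ^+ n.+1 + n.+1%:R * f * s ^+ n) - (s ^+ n.+2 + n.+2%:R * f * s ^+ n.+1)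
   = n.+1%:R * f ^+ 2 * s ^+ n by rewrite -[n.+2]add1n natrD !exprS; ring.
by rewrite !mulr_ge0 ?exprn_ge0.
Qed.

Lemma exptermD_ge n (s f : R) : 0 <= s -> 0 <= f ->
  expterm n.+1 s + f * expterm n s <= expterm n.+1 (s + f).
Proof.
move=> s0 f0; rewrite /expterm.
have fn0 : 0 < n`!%:R :> R by rewrite ltr0n fact_gt0.
rewrite ler_pdivlMr ?ltr0n ?fact_gt0 //; apply: le_trans (exprD_ge n s0 f0).
rewrite factS natrM le_eqVlt; apply/orP; left; apply/eqP.
by field; rewrite gt_eqF // addrC natr1 pnatr_eq0.
Qed.

(** The discrete form of the integral of f F^n / n! being F^(n+1) / (n+1)!, where F is
    the integral of f; the sum is over left end points, so it is at most that. *)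
Lemma psum_expterm f n y : (forall x, (x < y)%N -> 0 <= f x) ->
  \sum_(x < y) f x * expterm n (psum f x) <= expterm n.+1 (psum f y).
Proof.
elim: y => [|y IHy] hf; first by rewrite big_ord0 expterm_ge0 // /psum big_ord0.
rewrite big_ord_recr /= psumS.
have s0 : 0 <= psum f y by apply: sumr_ge0 => x _; apply: hf; apply: (ltn_trans (ltn_ord x)).
apply: le_trans (exptermD_ge n s0 (hf _ (ltnSn y))); rewrite lerD2r.
by apply: IHy => x xy; apply: hf; rewrite ltnW.
Qed.

Variables (a b c N : nat) (A B : R) (U V : nat -> R).
Let d := b.+1.
(* U and V play the roles of z^(a/d) and (1-z)^(c/d), so that f is U V *)
Hypotheses (A0 : 0 <= A) (B0 : 0 <= B).
Hypothesis U0 : forall x, 0 <= U x.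
Hypothesis V0 : forall x, 0 <= V x.
Hypothesis U_mono : forall x y, (x <= y)%N -> U x <= U y.
Hypothesis V_anti : forall x y, (x <= y)%N -> V y <= V x.
Hypothesis binU : forall x, (x < N)%N -> 'C(x, a)%:R <= A * U x ^+ d.
Hypothesis binV : forall x, (x < N)%N -> 'C(N - x.+1, c)%:R <= B * V x ^+ d.

Let S := psum (fun x => U x * V x).

Lemma S_ge0 x : 0 <= S x.
Proof. by apply: sumr_ge0 => y _; rewrite mulr_ge0. Qed.

Lemma iter_psum_ge0 h j y : (forall x, 0 <= h x) -> 0 <= iter j psum h y.
Proof. by move=> hh; elim: j y => [|j IHj] y //=; apply: sumr_ge0. Qed.

(** The weight U x ^ d V y ^ d of a step is spread over its d points: as U increases
    and V decreases, one factor U V can be given to each point in turn.  Here j of the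
    d points have been treated. *)
Lemma iter_psum_weight n j y : (j <= d)%N ->
  V y ^+ j * iter j psum (fun x => U x ^+ d * expterm n (S x)) y <=
  U y ^+ (d - j) * expterm (n + j) (S y).
Proof.
elim: j y => [|j IHj] y hj; first by rewrite expr0 mul1r subn0 addn0.
rewrite [iter _ _ _]/= addnS; set H := iter j _ _.
have H0 x : 0 <= H x.
  by apply: iter_psum_ge0 => z; rewrite mulr_ge0 ?exprn_ge0 ?expterm_ge0 ?S_ge0.
apply: (@le_trans _ _ (U y ^+ (d - j.+1) * \sum_(x < y) U x * V x * expterm (n + j) (S x))).
  rewrite /psum !mulr_sumr; apply: ler_sum => x _; have xy := ltnW (ltn_ord x).
  apply: (@le_trans _ _ (V x * (V x ^+ j * H x))).
    by rewrite mulrA -exprS ler_wpM2r // ler_pXn2r ?nnegrE // V_anti.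
  apply: (@le_trans _ _ (V x * (U x ^+ (d - j) * expterm (n + j) (S x)))).
    by rewrite ler_wpM2l // IHj // ltnW.
  rewrite (_ : d - j = (d - j.+1).+1)%N; last lia.
  rewrite exprS.
  have -> : V x * (U x * U x ^+ (d - j.+1) * expterm (n + j) (S x)) =
     U x ^+ (d - j.+1) * (U x * V x * expterm (n + j) (S x)) by ring.
  have E0 := expterm_ge0 (n + j) (S_ge0 x).
  apply: (ler_wpM2r (mulr_ge0 (mulr_ge0 (U0 x) (V0 x)) E0)).
  by rewrite lerXn2r ?nnegrE // U_mono.
rewrite ler_wpM2l ?exprn_ge0 //; apply: (psum_expterm (f := fun x => U x * V x)).
by move=> x _; rewrite mulr_ge0.
Qed.

Lemma reach_le k y : (y < N)%N ->
  (reach a b c N k y)%:R <= (A * B) ^+ k * expterm (k * d) (S y).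
Proof.
elim: k y => [|k IHk] y yN; first by rewrite mul0n expterm0 expr0 mulr1.
rewrite reachS // natrM natr_sum.
apply: (@le_trans _ _ (B * V y ^+ d * ((A * B) ^+ k * A *
   iter d psum (fun x => U x ^+ d * expterm (k * d) (S x)) y))); last first.
  have := iter_psum_weight (k * d) y (leqnn d); rewrite subnn expr0 mul1r mulSnr => h.
  rewrite exprSr; set X := iter _ _ _ _ in h *.
  have -> : B * V y ^+ d * ((A * B) ^+ k * A * X) = (A * B) ^+ k * (A * B) * (V y ^+ d * X) by ring.
  by rewrite ler_wpM2l // !mulr_ge0 ?exprn_ge0 // mulr_ge0.
apply: ler_pM => //; [by apply: sumr_ge0 | exact: binV |].
rewrite /d -convolution_iter_psum mulr_sumr; apply: ler_sum => x _.
have xN : (x < N)%N by apply: ltn_trans yN.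
rewrite !natrM mulrA ler_wpM2r //.
have -> : (A * B) ^+ k * A * (U x ^+ b.+1 * expterm (k * b.+1) (S x)) =
  (A * B) ^+ k * expterm (k * b.+1) (S x) * (A * U x ^+ b.+1) by ring.
by apply: ler_pM => //; [exact: IHk | exact: binU].
Qed.

Lemma total_walks_le k :
  (total_walks a b c N k)%:R <= N%:R * ((A * B) ^+ k * expterm (k * d) (S N)).
Proof.
rewrite total_walksE natr_sum.
apply: le_trans (_ : _ <= \sum_(y < N) (A * B) ^+ k * expterm (k * d) (S N)) _; last first.
  by rewrite sumr_const card_ord -[leLHS]mulr_natl.
apply: ler_sum => y _; apply: le_trans (reach_le _ (ltn_ord y)) _.
rewrite ler_wpM2l ?exprn_ge0 ?mulr_ge0 // ler_wpM2r ?invr_ge0 //.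
rewrite lerXn2r ?nnegrE ?S_ge0 // /S /psum.
rewrite (big_ord_widen N (fun x => U x * V x)); last by rewrite ltnW.
by rewrite big_mkcond; apply: ler_sum => x _; case: ifP => // _; rewrite mulr_ge0.
Qed.

End UpperBound.

Lemma bin_le_expn n k : 'C(n, k) <= n ^ k.
Proof.
apply: (@leq_trans ('C(n, k) * k`!)); first by rewrite leq_pmulr ?fact_gt0.
by rewrite bin_ffact ffact_le_expn.
Qed.

Lemma sum_shift (f : nat -> nat) z h :
  \sum_(z <= i < z + h) f i = \sum_(x < h) f (x + z).
Proof. by rewrite -{1}(add0n z) big_addn addKn big_mkord. Qed.

(** * Lower bound for the number of walks *)

Section LowerBound.
Variables (a b c N : nat).

Let w x := 'C(x, a) * 'C(N - x.+1, c).

(** [reach] without the factor for the letters above y, and with an extra factor for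
    the letters above the starting point.  Unlike [reach] it is nondecreasing in y. *)
Fixpoint climb (k y : nat) : nat :=
  if k is k'.+1 then \sum_(x < y) 'C(y - x.+1, b) * (w x * climb k' x) else 1.

Lemma climb_reach k y : y < N -> 'C(N - y.+1, c) * climb k y <= N ^ c * reach a b c N k y.
Proof.
elim: k y => [|k IHk] y yN.
  rewrite !muln1 (leq_trans (bin_le_expn _ _)) //.
  by have [->//|c0] := posnP c; rewrite leq_exp2r // leq_subr.
rewrite reachS // mulnCA leq_mul2l; apply/orP; right.
rewrite big_distrr; apply: leq_sum => x _ /=.
have -> : 'C(y - x.+1, b) * (w x * climb k x) =
    'C(x, a) * 'C(y - x.+1, b) * ('C(N - x.+1, c) * climb k x) by rewrite /w; ring.
have -> : N ^ c * (reach a b c N k x * 'C(x, a) * 'C(y - x.+1, b)) =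
    'C(x, a) * 'C(y - x.+1, b) * (N ^ c * reach a b c N k x) by ring.
by rewrite leq_mul2l IHk ?orbT // (ltn_trans (ltn_ord x) yN).
Qed.

Lemma climb_mono k y z : y <= z -> climb k y <= climb k z.
Proof.
move=> yz; case: k => [|k] //=.
rewrite (big_ord_widen z (fun x => 'C(y - x.+1, b) * (w x * climb k x)) yz).
rewrite big_mkcond; apply: leq_sum => x _; case: ifP => // xy.
by rewrite leq_mul2r leq_bin2l ?orbT // leq_sub2r.
Qed.

(** The last i steps are taken inside the interval from z to z+h, where each weight is
    at least mu; their d i points are then an arbitrary increasing choice.  The steps
    before them are bounded by those ending at z because the kernel is nondecreasing in
    its end point. *)
Lemma climb_add k z h mu : (forall x, z <= x < z + h -> mu <= w x) ->
  \sum_(i < k.+1) climb (k - i) z * (mu ^ i * 'C(h, i * b.+1)) <= climb k (z + h).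
Proof.
move=> hmu; elim: k h hmu => [|k IHk] h hmu.
  by rewrite big_ord1 /= mul0n bin0.
rewrite big_ord_recl /= expn0 mul0n bin0 !muln1.
rewrite -(big_mkord xpredT (fun x => 'C(z + h - x.+1, b) * (w x * climb k x))).
rewrite (@big_cat_nat _ _ _ z) //=; last exact: leq_addr.
rewrite big_mkord; apply: leq_add.
  by apply: leq_sum => x _; rewrite leq_mul2r leq_bin2l ?orbT // leq_sub2r // leq_addr.
rewrite sum_shift.
apply: (@leq_trans (\sum_(x < h) 'C(h.-1 - x, b) * (mu *
   \sum_(i < k.+1) climb (k - i) z * (mu ^ i * 'C(x, i * b.+1))))).
  under [leqRHS]eq_bigr => x _ do rewrite 2!big_distrr /=.
  rewrite exchange_big /=; apply: leq_sum => i _.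
  rewrite /bump /= add1n subSS mulSnr -sum_bin_bin !big_distrr /=.
  apply: leq_sum => x _; rewrite expnS; apply: eq_leq; ring.
apply: leq_sum => x _; rewrite (_ : z + h - (x + z).+1 = h.-1 - x); last first.
  have := ltn_ord x; lia.
rewrite leq_mul2l; apply/orP; right; rewrite addnC; apply: leq_mul.
  by apply: hmu; have := ltn_ord x; lia.
by apply: IHk => y hy; apply: hmu; have := ltn_ord x; lia.
Qed.

Lemma climb_total_walks k y : y <= N ->
  'C(N - y, c.+1) * climb k y <= N ^ c * total_walks a b c N k.
Proof.
move=> yN; rewrite total_walksE.
have hs := @sum_interval_bin N y N c (leqnn N).
rewrite -hs big_distrl big_distrr big_mkcond /=; apply: leq_sum => x _.
case: ifP => // /andP[yx _]; apply: leq_trans (climb_reach k (ltn_ord x)).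
by rewrite leq_mul2l climb_mono ?orbT.
Qed.

End LowerBound.

Section Blocks.
Local Open Scope ring_scope.
Variable R : realFieldType.

Lemma sum_triangle (f g : nat -> R) n :
  \sum_(k < n) \sum_(i < k.+1) f (k - i)%N * g i =
  \sum_(i < n) (\sum_(l < n - i) f l) * g i.
Proof.
elim: n => [|n IHn]; first by rewrite !big_ord0.
rewrite big_ord_recr /= IHn [RHS]big_ord_recr /= subSnn big_ord1.
rewrite [X in _ + X = _]big_ord_recr /= subnn addrA -big_split /=; congr (_ + _).
apply: eq_bigr => i _; rewrite -mulrDl subSn ?big_ord_recr //.
by rewrite ltnW.
Qed.

Lemma sum_mul_le (f g : nat -> R) p q : (forall k, 0 <= f k) -> (forall k, 0 <= g k) ->
  (\sum_(l < p.+1) f l) * (\sum_(i < q.+1) g i) <=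
  \sum_(k < (p + q).+1) \sum_(i < k.+1) f (k - i)%N * g i.
Proof.
move=> f0 g0; rewrite sum_triangle mulr_sumr.
rewrite (big_ord_widen (p + q).+1 (fun i => (\sum_(l < p.+1) f l) * g i)); last by rewrite ltnS leq_addl.
rewrite big_mkcond; apply: ler_sum => i _; case: ifP => [iq|_]; last by rewrite mulr_ge0 ?sumr_ge0.
rewrite ler_wpM2r // (big_ord_widen ((p + q).+1 - i) f); last by move: iq; lia.
by rewrite big_mkcond; apply: ler_sum => l _; case: ifP.
Qed.

Variables (a b c L M : nat) (t : R).
Hypothesis t0 : 0 <= t.
Let N := (M.+1 * L)%N.

Definition block_weight j := ('C(j * L, a) * 'C(N - j.+1 * L, c))%N.

(** The alphabet is cut into M+1 blocks of L letters.  Generating functions in t turn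
    the distribution of the steps among the blocks into a product; at most K steps are
    taken in each block, which keeps all sums finite. *)
Lemma climb_blocks K j : (j <= M)%N ->
  \prod_(i < j) \sum_(l < K.+1) t ^+ l * (block_weight i ^ l * 'C(L, l * b.+1))%N%:R <=
  \sum_(k < (j * K).+1) t ^+ k * (climb a b c N k (j * L))%:R.
Proof.
elim: j => [|j IHj] jM; first by rewrite big_ord0 big_ord1 expr0 mul1r.
rewrite big_ord_recr /=.
set g := fun l => t ^+ l * (block_weight j ^ l * 'C(L, l * b.+1))%N%:R.
apply: (@le_trans _ _ ((\sum_(k < (j * K).+1) t ^+ k * (climb a b c N k (j * L))%:R) *
    \sum_(l < K.+1) g l)).
  by rewrite ler_wpM2r ?IHj ?sumr_ge0 // => [l _|]; rewrite ?mulr_ge0 ?exprn_ge0 ?ler0n // ltnW.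
rewrite [in leRHS]mulSn [in leRHS](addnC K).
apply: le_trans (sum_mul_le (f := fun k => t ^+ k * (climb a b c N k (j * L))%:R) _ _ _ _) _.
- by move=> k; rewrite mulr_ge0 ?exprn_ge0 ?ler0n.
- by move=> k; rewrite mulr_ge0 ?exprn_ge0 ?ler0n.
apply: ler_sum => k _; rewrite mulSn (addnC L).
apply: le_trans (_ : _ <= t ^+ k * (\sum_(i < k.+1) climb a b c N (k - i) (j * L) *
   (block_weight j ^ i * 'C(L, i * b.+1)))%N%:R) _; last first.
  rewrite ler_wpM2l ?exprn_ge0 // ler_nat climb_add // => x hx.
  by rewrite leq_mul // leq_bin2l //; move: hx; rewrite ?mulSn; lia.
rewrite natr_sum mulr_sumr; apply: ler_sum => i _; rewrite /g.
have -> : t ^+ k = t ^+ (k - i) * t ^+ i by rewrite -exprD subnK // -ltnS.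
by rewrite !natrM le_eqVlt; apply/orP; left; apply/eqP; ring.
Qed.

(** The last block provides the end point of the walk, and C(L, c+1) counts the choices
    of this point together with the letters above it. *)
Lemma total_walks_ge K :
  ('C(L, c.+1))%:R * \prod_(i < M) \sum_(l < K.+1)
      t ^+ l * (block_weight i ^ l * 'C(L, l * b.+1))%N%:R <=
  N%:R ^+ c * \sum_(k < (M * K).+1) t ^+ k * (total_walks a b c N k)%:R.
Proof.
apply: le_trans (ler_wpM2l (ler0n _ _) (climb_blocks K (leqnn M))) _.
rewrite !mulr_sumr; apply: ler_sum => k _; rewrite !(mulrCA _ (t ^+ k)) ler_wpM2l ?exprn_ge0 //.
rewrite -natrX -!natrM ler_nat; have := @climb_total_walks a b c N k (M * L)%N.
by rewrite {1 2}/N mulSn leq_addl addnK; apply.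
Qed.

End Blocks.

(** * Two chained windows when the end letters are adjacent in value *)

Lemma total_walks2 a c N : total_walks a 0 c N 2 =
  \sum_(y < N) ('C(y, a) * 'C(y, a.+1)) * ('C(N - y.+1, c) * 'C(N - y.+1, c.+1)).
Proof.
rewrite total_walksE -(reach_walks _ _ _ _ 1 1); apply: eq_bigr => y _.
rewrite reachS // /=.
have -> : \sum_(x < y) 1 * 'C(x, a) * 'C(y - x.+1, 0) = 'C(y, a.+1).
  by rewrite -hockey_stick; apply: eq_bigr => x _; rewrite mul1n bin0 muln1.
have -> : \sum_(z < N) step a 0 c N y z * 1 = 'C(y, a) * 'C(N - y.+1, c.+1).
  rewrite -(@sum_interval_bin N y.+1 N c (leqnn N)) [in RHS]big_mkcond big_distrr /=.
  apply: eq_bigr => z _; rewrite /step ltn_ord andbT muln1.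
  by case: ifP; rewrite ?muln0 // bin0 muln1.
ring.
Qed.

Lemma bin_double_fact a : 'C(a.*2.+1, a) * (a`! * a.+1`!) = a.*2.+1`!.
Proof.
have h1 : a <= a.*2.+1 by lia.
have h2 : a.*2.+1 - a = a.+1 by lia.
by have := bin_fact h1; rewrite h2.
Qed.

(** Pairs of disjoint subsets of sizes a and a+1 are counted on the left. *)
Lemma bin_mul_ge y a : 'C(a.*2.+1, a) * 'C(y, a.*2.+1) <= 'C(y, a) * 'C(y, a.+1).
Proof.
have [h|h] := ltnP y a.*2.+1; first by rewrite (bin_small h) muln0.
have e := bin_double_fact a.
rewrite -(leq_pmul2r (_ : 0 < a`! * a.+1`!)); last by rewrite muln_gt0 !fact_gt0.
rewrite mulnAC e mulnC bin_ffact mulnACA !bin_ffact.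
have -> : a.*2.+1 = a + a.+1 by lia.
elim: (a.+1) => [|k IHk]; first by rewrite addn0 ffactn0 muln1.
by rewrite addnS !ffactnSr mulnA leq_mul // leq_sub2l // leq_addl.
Qed.

Lemma bin_mul_le y a : 'C(y, a) * 'C(y, a.+1) <= 'C(a.*2.+1, a) * 'C(y + a.*2.+1, a.*2.+1).
Proof.
have e := bin_double_fact a.
rewrite -(leq_pmul2r (_ : 0 < a`! * a.+1`!)); last by rewrite muln_gt0 !fact_gt0.
rewrite [leqRHS]mulnAC e [leqRHS]mulnC bin_ffact mulnACA !bin_ffact.
apply: (@leq_trans (y ^ a.*2.+1)).
  by rewrite (_ : a.*2.+1 = a + a.+1); [rewrite expnD leq_mul ?ffact_le_expn|lia].
elim: (a.*2.+1) => [|k IHk]; first by rewrite ffactn0.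
by rewrite addnS ffactSS expnS leq_mul //; lia.
Qed.

Lemma total_walks2_bounds a c N (n := (a.*2 + c.*2).+3)
  (r := 'C(a.*2.+1, a) * 'C(c.*2.+1, c)) : r * 'C(N, n) <= total_walks a 0 c N 2 <= r * 'C(N + n.-1, n).
Proof.
rewrite total_walks2; apply/andP; split.
  have := sum_bin_bin N a.*2.+1 c.*2.+1.
  rewrite (_ : _ + _ = n); last by rewrite /n; lia.
  move=> <-; rewrite big_distrr; apply: leq_sum => y _.
  rewrite (_ : N.-1 - y = N - y.+1); last lia.
  by rewrite /= /r [leqLHS]mulnACA leq_mul ?bin_mul_ge.
have := sum_bin_bin (N + n.-1) a.*2.+1 c.*2.+1.
rewrite (_ : _ + _.+2 = n); last by rewrite /n; lia.
move=> <-; apply: (@leq_trans (\sum_(y < N) r * ('C(y + a.*2.+1, a.*2.+1) *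
   'C(N - y.+1 + c.*2.+1, c.*2.+1)))).
  by apply: leq_sum => y _; rewrite /r [leqRHS]mulnACA leq_mul ?bin_mul_le.
rewrite big_distrr /=.
rewrite -(big_mkord xpredT (fun y => r * ('C(y, a.*2.+1) * 'C((N + n.-1).-1 - y, c.*2.+1)))).
rewrite (@big_cat_nat _ _ _ a.*2.+1) //=; last by rewrite /n; lia.
rewrite (_ : N + (a.*2 + c.*2).+2 = a.*2.+1 + (N + c.*2.+1)); last lia.
rewrite sum_shift -(big_mkord xpredT (fun x => r * ('C(x + a.*2.+1, a.*2.+1) *
  'C((a.*2.+1 + (N + c.*2.+1)).-1 - (x + a.*2.+1), c.*2.+1)))).
apply: leq_trans (leq_addl _ _).
rewrite (@big_cat_nat _ _ _ N) //=; last exact: leq_addr.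
apply: leq_trans (leq_addr _ _).
rewrite big_mkord; apply: leq_sum => y _.
by rewrite leq_mul2l leq_mul2l leq_bin2l ?orbT //; have := ltn_ord y; lia.
Qed.

Lemma expn_shift n k : exists E, forall N, 0 < N -> (N + n) ^ k * N <= N ^ k * (N + E).
Proof.
elim: k => [|k [E hE]]; first by exists 0 => N _; rewrite addn0.
exists (n + E + n * E) => N N0; rewrite !expnS -!mulnA.
apply: (@leq_trans ((N + n) * (N ^ k * (N + E)))); first by rewrite leq_mul2l hE ?orbT.
rewrite mulnCA [leqRHS]mulnCA leq_mul2l; apply/orP; right; nia.
Qed.

(** The coefficient of N^n / n! in the number of chains of two windows, when the first
    and the last letter of the pattern are adjacent in value. *)
Definition two_windows a c := 'C(a.*2.+1, a) * 'C(c.*2.+1, c).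

(** Both bounds of [total_walks2_bounds] are the same multiple of N^n / n! up to
    O(N^(n-1)). *)
Lemma two_windows_le a c a' c' C : a + c = a' + c' ->
  (forall N, total_walks a' 0 c' N 2 * N <= total_walks a 0 c N 2 * N + C * N ^ ((a + c).*2.+3)) ->
  two_windows a' c' <= two_windows a c.
Proof.
move=> hac h; rewrite leqNgt; apply/negP => hlt.
have n1 : (a.*2 + c.*2).+3 = (a + c).*2.+3 by lia.
have n2 : (a'.*2 + c'.*2).+3 = (a + c).*2.+3 by lia.
set n := (a + c).*2.+3 in n1 n2 h.
have [E hE] := expn_shift n n.
pose r := two_windows a c; pose r' := two_windows a' c'.
(* N exceeds all error terms divided by N^n *)
pose N := (r * E + C * n`! + r' * (n * n)).+1.
have N0 : 0 < N by [].
have /andP[low _] := total_walks2_bounds a' c' N.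
have /andP[_ upp] := total_walks2_bounds a c N.
rewrite n2 -/(two_windows a' c') -/r' in low; rewrite n1 -/(two_windows a c) -/r in upp.
have f0 : 0 < n`! := fact_gt0 n.
have {}low : r' * N ^_ n <= total_walks a' 0 c' N 2 * n`! by rewrite -bin_ffact mulnA leq_mul2r low orbT.
have {}upp : total_walks a 0 c N 2 * n`! <= r * (N + n) ^ n.
  apply: (@leq_trans (r * (N + n.-1) ^_ n)); first by rewrite -bin_ffact mulnA leq_mul2r upp orbT.
  rewrite leq_mul2l; apply/orP; right; apply: leq_trans (ffact_le_expn _ _) _.
  by rewrite leq_exp2r ?leq_add2l ?leq_pred.
have hw : total_walks a' 0 c' N 2 * n`! * N <= total_walks a 0 c N 2 * n`! * N + C * n`! * N ^ n.
  have := h N; rewrite -(leq_pmul2r f0) mulnDl.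
  by rewrite !(mulnAC _ _ n`!).
have hf := expn_ffact N n; have hs := hE N N0.
have P0 : 0 < N ^ n by rewrite expn_gt0 N0.
have s1 : r' * (N ^ n * N) <= r' * (N ^_ n * N) + r' * (n * n) * N ^ n.
  by rewrite -mulnA -mulnDr leq_mul2l hf orbT.
have s2 : r' * (N ^_ n * N) <= r * ((N + n) ^ n * N) + C * n`! * N ^ n.
  rewrite mulnA; apply: (leq_trans (leq_mul low (leqnn N))); apply: (leq_trans hw).
  by rewrite leq_add2r mulnA leq_mul2r upp orbT.
have s3 : r * ((N + n) ^ n * N) <= r * (N ^ n * (N + E)) by rewrite leq_mul2l hs orbT.
have s4 : N ^ n * (r' * N) <= N ^ n * (r * (N + E) + C * n`! + r' * (n * n)).
  have -> : N ^ n * (r * (N + E) + C * n`! + r' * (n * n)) =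
    r * (N ^ n * (N + E)) + C * n`! * N ^ n + r' * (n * n) * N ^ n by ring.
  rewrite mulnCA; apply: (leq_trans s1); rewrite leq_add2r.
  by apply: (leq_trans s2); rewrite leq_add2r.
have s5 : r' * N <= r * (N + E) + C * n`! + r' * (n * n) by rewrite -(leq_pmul2l P0).
have s6 : r.+1 * N <= r' * N by rewrite leq_mul2r hlt orbT.
have : r.+1 * N <= r * N + (r * E + C * n`! + r' * (n * n)).
  by apply: (leq_trans s6); apply: (leq_trans s5); rewrite mulnDr !addnA.
by rewrite mulSn addnC leq_add2l /N ltnn.
Qed.

Lemma bin_doubleS a : a.+2 * 'C(a.+1.*2.+1, a.+1) = 2 * (a.*2 + 3) * 'C(a.*2.+1, a).
Proof.
have e1 := bin_double_fact a; have e2 := bin_double_fact a.+1.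
have f1 := fact_gt0 a; have f2 := fact_gt0 a.+1.
have e3 : a.+1.*2.+1 = a.*2.+3 by lia.
rewrite e3 in e2 *.
have e7 : a.*2.+2 = 2 * a.+1 by lia.
have e4 : a.*2.+3`! = a.*2.+3 * (2 * a.+1 * a.*2.+1`!) by rewrite -e7 !factS.
have e5 : a.+2`! = a.+2 * a.+1`! by rewrite factS.
have e6 : a.+1`! = a.+1 * a`! by rewrite factS.
rewrite e4 -e1 e5 in e2.
have P : 0 < a.+1`! * a.+1`! by rewrite muln_gt0 f2.
apply/eqP; rewrite -(eqn_pmul2r P); apply/eqP.
transitivity ('C(a.*2.+3, a.+1) * (a.+1`! * (a.+2 * a.+1`!))); first by ring.
rewrite e2 -addn3 {3}e6; ring.
Qed.

(** By [bin_doubleS] the ratio of consecutive values of C(2a+1, a) is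
    2 (2a+3) / (a+2), which increases with a. *)
Lemma two_windows_step a c : a < c -> two_windows a.+1 c < two_windows a c.+1.
Proof.
move=> ac; rewrite /two_windows.
have ha := bin_doubleS a; have hc := bin_doubleS c.
have pa : 0 < 'C(a.*2.+1, a) by rewrite bin_gt0; lia.
have pc : 0 < 'C(c.*2.+1, c) by rewrite bin_gt0; lia.
move: ('C(a.*2.+1, a)) ('C(c.*2.+1, c)) ('C(a.+1.*2.+1, a.+1)) ('C(c.+1.*2.+1, c.+1)) pa pc ha hc.
move=> x y x' y' x0 y0 ha hc.
rewrite -(ltn_pmul2l (_ : 0 < a.+2 * c.+2)) //.
have -> : a.+2 * c.+2 * (x' * y) = c.+2 * y * (a.+2 * x') by ring.
have -> : a.+2 * c.+2 * (x * y') = a.+2 * x * (c.+2 * y') by ring.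
rewrite ha hc.
have -> : c.+2 * y * (2 * (a.*2 + 3) * x) = 2 * x * y * (c.+2 * (a.*2 + 3)) by ring.
have -> : a.+2 * x * (2 * (c.*2 + 3) * y) = 2 * x * y * (a.+2 * (c.*2 + 3)) by ring.
rewrite ltn_pmul2l; last by rewrite !muln_gt0 x0 y0.
by rewrite -!mul2n; nia.
Qed.

Lemma two_windows_lt a j e :
  two_windows (a + j.+1) (a + j.+1 + e) < two_windows a (a + j.+1 + e + j.+1).
Proof.
elim: j a => [|j IHj] a.
  by rewrite !addn1; apply: two_windows_step; lia.
apply: (@ltn_trans (two_windows a.+1 (a + j.+2 + e + j.+1))); last first.
  by rewrite (addnS (a + j.+2 + e) j.+1); apply: two_windows_step; lia.
have -> : a + j.+2 = a.+1 + j.+1 by lia.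
exact: IHj.
Qed.

End WalkBounds.

From mathcomp Require Import Rstruct.
From Stdlib Require Import Reals Lra Lia Ring Field.
From Coquelicot Require Import Coquelicot.

(** * The Beta integral with exponents a/d and c/d *)

Section Root.
Open Scope R_scope.
Variable d : nat.
Hypothesis d_gt0 : (0 < d)%coq_nat.

(** The d-th root, extended by 0 to the negative numbers so that it is continuous
    everywhere; [Rpower] alone has the value 1 at 0. *)
Definition root (x : R) : R := if Rle_dec x 0 then 0 else Rpower x (/ INR d).

Lemma root_le0 x : x <= 0 -> root x = 0.
Proof. by move=> h; rewrite /root; destruct (Rle_dec x 0). Qed.

Lemma root_pos x : 0 < x -> root x = Rpower x (/ INR d).
Proof. by move=> h; rewrite /root; destruct (Rle_dec x 0) => //; lra. Qed.

Lemma INR_d_gt0 : 0 < INR d. Proof. exact: lt_0_INR. Qed.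

Lemma root_ge0 x : 0 <= root x.
Proof. by rewrite /root; destruct (Rle_dec x 0) => /=; [lra|apply: Rlt_le; exact: exp_pos]. Qed.

Lemma root_gt0 x : 0 < x -> 0 < root x.
Proof. by move=> h; rewrite root_pos //; exact: exp_pos. Qed.

Lemma root_pow x : 0 <= x -> root x ^ d = x.
Proof.
move=> h; have := INR_d_gt0 => hd; case: (Rle_lt_or_eq_dec 0 x h) => [x0|<-].
  rewrite root_pos // -Rpower_pow; last exact: exp_pos.
  rewrite Rpower_mult Rinv_l; last lra.
  exact: Rpower_1.
rewrite root_le0; last lra.
by rewrite pow_i.
Qed.

Lemma root_mono x y : x <= y -> root x <= root y.
Proof.
move=> xy; case: (Rle_dec x 0) => x0.
  by rewrite (root_le0 x0); exact: root_ge0.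
rewrite !root_pos; try lra.
apply: Rle_Rpower_l; last lra.
by apply: Rlt_le; apply: Rinv_0_lt_compat; exact: INR_d_gt0.
Qed.

Lemma root_unique x y : 0 <= x -> 0 <= y -> x ^ d = y -> x = root y.
Proof.
move=> x0 y0 hxy; have hy := root_pow y0.
have rp := root_ge0 y.
have mono u v : 0 <= u -> u < v -> u ^ d < v ^ d.
  move=> u0 uv; case: (d) d_gt0 => [|n] hn; first by lia.
  elim: n {hn} => [|n IHn]; first by rewrite !pow_1.
  change (u * u ^ n.+1 < v * v ^ n.+1); apply: Rmult_le_0_lt_compat => //; apply: pow_le => //.
case: (Rtotal_order x (root y)) => [h|[//|h]].
- by have := mono _ _ x0 h; lra.
- by have := mono _ _ rp h; lra.
Qed.

Lemma root1 : root 1 = 1.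
Proof. by symmetry; apply: root_unique; try lra; rewrite pow1. Qed.

Lemma root_le1 x : x <= 1 -> root x <= 1.
Proof. by move=> h; rewrite -root1; exact: root_mono. Qed.

Lemma continuous_root x : continuous root x.
Proof.
case: (Rtotal_order x 0) => [x0|[->|x0]].
- apply: (continuous_ext_loc _ (fun=> 0)); last exact: continuous_const.
  by apply: (locally_interval _ x m_infty 0) => // y _ y0; rewrite root_le0 //=; apply: Rlt_le.
- apply/filterlim_locally => eps; have e0 := cond_pos eps.
  exists (mkposreal _ (pow_lt eps d e0)) => y.
  rewrite /ball /= /AbsRing_ball /= /abs /minus /plus /opp /= => hy.
  rewrite (@root_le0 0); last lra.
  rewrite Ropp_0 Rplus_0_r; rewrite Ropp_0 Rplus_0_r in hy; rewrite (Rabs_pos_eq _ (root_ge0 y)).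
  case: (Rle_dec y 0) => y0; first by rewrite root_le0.
  apply: Rnot_le_lt => h; have : eps ^ d <= root y ^ d by apply: pow_incr; lra.
  by rewrite root_pow; [have := Rle_abs y; lra|lra].
- apply: (continuous_ext_loc _ (fun y => Rpower y (/ INR d))).
    by apply: (locally_interval _ x 0 p_infty) => // y y0 _; rewrite root_pos.
  apply: (@ex_derive_continuous R_AbsRing R_NormedModule).
  by rewrite /Rpower; auto_derive.
Qed.

(** The factor y makes the function differentiable at 0 as well, where the end points
    of the integral lie; this is the power y^((k+d)/d). *)
Lemma is_derive_mul_root_pow k x :
  is_derive (fun y => y * root y ^ k) x ((INR k + INR d) / INR d * root x ^ k).
Proof.
have hd := INR_d_gt0.
case: k => [|k].
  rewrite /=; replace ((0 + INR d) / INR d * 1) with 1 by (field; lra).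
  by apply: (is_derive_ext (fun y => y)) => [t|]; [rewrite /= Rmult_1_r|exact: is_derive_id].
case: (Rtotal_order x 0) => [x0|[->|x0]].
- rewrite root_le0; last lra.
  replace ((INR k.+1 + INR d) / INR d * 0 ^ k.+1) with 0 by (rewrite /=; ring).
  apply: (is_derive_ext_loc (fun=> 0)); last exact: is_derive_const.
  apply: (locally_interval _ x m_infty 0) => // y _ y0; rewrite root_le0 /=; last exact: Rlt_le.
  by rewrite /=; ring.
- rewrite root_le0; last lra.
  replace ((INR k.+1 + INR d) / INR d * 0 ^ k.+1) with 0 by (rewrite /=; ring).
  split; first exact: is_linear_scal_l.
  move=> z hz; have <- : 0 = z by apply: (is_filter_lim_locally_unique 0 z).
  move=> eps; have e0 := cond_pos eps.
  have : continuous (fun y => root y ^ k.+1) 0.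
    apply: (continuous_comp root (fun y => y ^ k.+1)); first exact: continuous_root.
    by apply: (@ex_derive_continuous R_AbsRing R_NormedModule); auto_derive.
  move=> /filterlim_locally /(_ eps); apply: filter_imp => y.
  rewrite /ball /= /AbsRing_ball /norm /= /abs /minus /plus /opp /scal /= /mult /=.
  rewrite (@root_le0 0); last lra.
  move=> h; replace (y * (root y * root y ^ k) + - (0 * (0 * 0 ^ k)) + - ((y + - 0) * 0))
    with (y * (root y * root y ^ k)) by ring.
  replace (root y * root y ^ k + - (0 * 0 ^ k)) with (root y * root y ^ k) in h by ring.
  rewrite Rabs_mult Ropp_0 Rplus_0_r Rmult_comm; apply: Rmult_le_compat_r; first exact: Rabs_pos.
  by apply: Rlt_le.
- apply: (is_derive_ext_loc (fun y => y * Rpower y (/ INR d) ^ k.+1)).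
    by apply: (locally_interval _ x 0 p_infty) => // y y0 _; rewrite root_pos.
  rewrite root_pos // /Rpower; auto_derive => //.
  set E := exp _; change (E ^ k.+1) with (E * E ^ k).
  rewrite -[match k with | 0%nat => 1 | S _ => INR k + 1 end]/(INR k.+1).
  by field; lra.
Qed.

Definition beta_fun (a g : nat) x := root x ^ a * root (1 - x) ^ g.
Definition W (a g : nat) : R := RInt (beta_fun a g) 0 1.

Lemma continuous_root_pow k x : continuous (fun y => root y ^ k) x.
Proof.
apply: (continuous_comp root (fun y => y ^ k)); first exact: continuous_root.
by apply: (@ex_derive_continuous R_AbsRing R_NormedModule); auto_derive.
Qed.

Lemma continuous_reflect (f : R -> R) x : continuous f (1 - x) -> continuous (fun y => f (1 - y)) x.
Proof.
move=> h; apply: (continuous_comp (fun y => 1 - y) f) => //.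
by apply: (@ex_derive_continuous R_AbsRing R_NormedModule); auto_derive.
Qed.

Lemma continuous_beta a g x : continuous (beta_fun a g) x.
Proof.
apply: (continuous_mult (fun y => root y ^ a) (fun y => root (1 - y) ^ g)).
  exact: continuous_root_pow.
by apply: (continuous_reflect (f := fun y => root y ^ g)); exact: continuous_root_pow.
Qed.

Lemma ex_RInt_beta a g x y : ex_RInt (beta_fun a g) x y.
Proof. by apply: ex_RInt_continuous => z _; exact: continuous_beta. Qed.

Lemma W_gt0 a g : 0 < W a g.
Proof.
apply: RInt_gt_0; first lra; last by move=> x _; exact: continuous_beta.
by move=> x hx; apply: Rmult_lt_0_compat; apply: pow_lt; apply: root_gt0; lra.
Qed.

(** Because z + (1 - z) = 1. *)
Lemma W_split a g : W (a + d) g + W a (g + d) = W a g.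
Proof.
symmetry; apply: is_RInt_unique.
apply: (is_RInt_ext (fun x => beta_fun (a + d) g x + beta_fun a (g + d) x)); last first.
  by apply: is_RInt_plus; apply: RInt_correct; exact: ex_RInt_beta.
move=> x; rewrite Rmin_left ?Rmax_right; try lra; move=> hx.
by rewrite /beta_fun !pow_add !root_pow; lra.
Qed.

(** The derivative of z^((a+d)/d) (1-z)^((g+d)/d), which vanishes at both ends. *)
Lemma W_by_parts a g : (INR g + INR d) * W (a + d) g = (INR a + INR d) * W a (g + d).
Proof.
have hd := INR_d_gt0.
pose F x := (INR a + INR d) / INR d * beta_fun a (g + d) x -
            (INR g + INR d) / INR d * beta_fun (a + d) g x.
have hF : is_RInt F 0 1 ((INR a + INR d) / INR d * W a (g + d) -
            (INR g + INR d) / INR d * W (a + d) g).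
  apply: is_RInt_minus; apply: is_RInt_scal; apply: RInt_correct; exact: ex_RInt_beta.
pose G x := (x * root x ^ a) * ((1 - x) * root (1 - x) ^ g).
have hG : is_RInt F 0 1 (G 1 - G 0).
  apply: (is_RInt_ext (fun x => (INR a + INR d) / INR d * root x ^ a * ((1 - x) * root (1 - x) ^ g) +
      (x * root x ^ a) * (- ((INR g + INR d) / INR d * root (1 - x) ^ g)))).
    move=> x; rewrite Rmin_left ?Rmax_right; try lra; move=> hx.
    by rewrite /F /beta_fun !pow_add !root_pow; lra.
  apply: (is_RInt_derive G) => x _.
    rewrite /G; apply: (is_derive_mult (fun x => x * root x ^ a) (fun x => (1 - x) * root (1 - x) ^ g)).
    - exact: is_derive_mul_root_pow.
    - have h := is_derive_mul_root_pow g (1 - x).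
      have := is_derive_comp (fun y => y * root y ^ g) (fun y => 1 - y) x _ (-1) h.
      rewrite /scal /= /mult /= => h'.
      replace (- ((INR g + INR d) / INR d * root (1 - x) ^ g)) with
        (-1 * ((INR g + INR d) / INR d * root (1 - x) ^ g)) by ring.
      by apply: h'; auto_derive => //; ring.
    - by move=> n m; exact: Rmult_comm.
  have c1 k y : continuous (fun x => root x ^ k) y by exact: continuous_root_pow.
  have cid y : continuous (fun x : R => x) y by exact: continuous_id.
  have cm u v y : continuous u y -> continuous v y -> continuous (fun x => u x * v x) y.
    exact: continuous_mult.
  have cc (k : R) y : continuous (fun _ : R => k) y by exact: continuous_const.
  apply: (continuous_plus (fun x => (INR a + INR d) / INR d * root x ^ a * ((1 - x) * root (1 - x) ^ g))
    (fun x => (x * root x ^ a) * (- ((INR g + INR d) / INR d * root (1 - x) ^ g)))).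
  - apply: (cm _ _ _); first by apply: (cm _ _ _).
    by apply: (continuous_reflect (f := fun y => y * root y ^ g)); apply: (cm _ _ _).
  - apply: (cm _ _ _); first by apply: (cm _ _ _).
    apply: (continuous_opp (fun x => (INR g + INR d) / INR d * root (1 - x) ^ g)).
    by apply: (cm _ _ _) => //; apply: (continuous_reflect (f := fun y => root y ^ g)).
have e : G 1 - G 0 = 0 by rewrite /G; ring.
rewrite e in hG; have h := is_RInt_unique _ _ _ _ hF; rewrite (is_RInt_unique _ _ _ _ hG) in h.
apply: (Rmult_eq_reg_r (/ INR d)); last by apply: Rinv_neq_0_compat; lra.
rewrite /Rdiv in h; lra.
Qed.

Lemma W_addr a g : (INR a + INR g + 2 * INR d) * W a (g + d) = (INR g + INR d) * W a g.
Proof. by have := W_split a g; have := W_by_parts a g => h1 h2; rewrite -h2; lra. Qed.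

Lemma W_addl a g : (INR a + INR g + 2 * INR d) * W (a + d) g = (INR a + INR d) * W a g.
Proof. by have := W_split a g; have := W_by_parts a g => h1 h2; rewrite -h2; lra. Qed.

(** Cauchy-Schwarz, by the discriminant of the square of l (1-z)^(1/d) - z^(1/d). *)
Lemma W_log_convex a g : W a.+1 g.+1 ^ 2 <= W a g.+2 * W a.+2 g.
Proof.
have quad l : 0 <= l ^ 2 * W a g.+2 - 2 * l * W a.+1 g.+1 + W a.+2 g.
  pose F x := l ^ 2 * beta_fun a g.+2 x - 2 * l * beta_fun a.+1 g.+1 x + beta_fun a.+2 g x.
  have hF : is_RInt F 0 1 (l ^ 2 * W a g.+2 - 2 * l * W a.+1 g.+1 + W a.+2 g).
    apply: is_RInt_plus; last by apply: RInt_correct; exact: ex_RInt_beta.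
    by apply: is_RInt_minus; apply: is_RInt_scal; apply: RInt_correct; exact: ex_RInt_beta.
  rewrite -(is_RInt_unique _ _ _ _ hF); apply: RInt_ge_0; first lra; first by eexists; exact: hF.
  move=> x hx; rewrite /F /beta_fun.
  replace (_ + _) with ((l * root (1 - x) - root x) ^ 2 * (root x ^ a * root (1 - x) ^ g)) by (rewrite /=; ring).
  apply: Rmult_le_pos; first exact: pow2_ge_0.
  by apply: Rmult_le_pos; apply: pow_le; exact: root_ge0.
have w0 := W_gt0 a g.+2.
have := quad (W a.+1 g.+1 / W a g.+2); set p := W a g.+2 in w0 *; set q := W a.+1 g.+1.
replace ((q / p) ^ 2 * p - 2 * (q / p) * q + W a.+2 g) with ((p * W a.+2 g - q ^ 2) / p) by (field; lra).
move=> h; have : 0 <= (p * W a.+2 g - q ^ 2) / p * p by apply: Rmult_le_pos => //; lra.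
by rewrite /Rdiv Rmult_assoc Rinv_l; lra.
Qed.

Fixpoint rsum (f : nat -> R) n := if n is n'.+1 then rsum f n' + f n' else 0.

Lemma rsumS f n : rsum f n.+1 = rsum f n + f n. Proof. by []. Qed.

(** On each subinterval the increasing factor is taken at the left end and the
    decreasing factor at the right end. *)
Definition lower_sum a g n :=
  rsum (fun j => root (INR j / INR n) ^ a * root (1 - INR j.+1 / INR n) ^ g) n / INR n.

Lemma RInt_beta_bounds a g n j : (0 < n)%coq_nat -> (j <= n)%coq_nat ->
  rsum (fun j => root (INR j / INR n) ^ a * root (1 - INR j.+1 / INR n) ^ g) j / INR n <=
  RInt (beta_fun a g) 0 (INR j / INR n) <=
  rsum (fun j => root (INR j.+1 / INR n) ^ a * root (1 - INR j / INR n) ^ g) j / INR n.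
Proof.
move=> n0 jn; have hn : 0 < INR n by exact: lt_0_INR.
elim: j jn => [|j IHj] jn.
  by rewrite /= /Rdiv !Rmult_0_l RInt_point /zero /=; lra.
have {}IHj := IHj ltac:(lia).
have hj : INR j.+1 / INR n - INR j / INR n = / INR n by rewrite S_INR; field; lra.
have hi : 0 < / INR n by exact: Rinv_0_lt_compat.
rewrite -(RInt_Chasles _ 0 (INR j / INR n) (INR j.+1 / INR n)); try exact: ex_RInt_beta.
rewrite !rsumS; rewrite -[plus _ _]/(_ + _).
set x := INR j / INR n in hj IHj *; set y := INR j.+1 / INR n in hj *.
have mono z : x < z < y -> root x ^ a * root (1 - y) ^ g <= beta_fun a g z <= root y ^ a * root (1 - x) ^ g.
  move=> hz; split; apply: Rmult_le_compat; try (apply: pow_le; exact: root_ge0);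
    apply: pow_incr; (split; first exact: root_ge0); apply: root_mono; lra.
have b1 : RInt (fun _ => root x ^ a * root (1 - y) ^ g) x y <= RInt (beta_fun a g) x y.
  apply: RInt_le; first lra; [exact: ex_RInt_const|exact: ex_RInt_beta|].
  by move=> z /mono[].
have b2 : RInt (beta_fun a g) x y <= RInt (fun _ => root y ^ a * root (1 - x) ^ g) x y.
  apply: RInt_le; first lra; [exact: ex_RInt_beta|exact: ex_RInt_const|].
  by move=> z /mono[].
rewrite !RInt_const /scal /= /mult /= hj in b1 b2.
rewrite /Rdiv !Rmult_plus_distr_r; rewrite /Rdiv in IHj; lra.
Qed.

Lemma lower_sum_le a g n : (0 < n)%coq_nat -> lower_sum a g n <= W a g.
Proof.
move=> n0; have [h _] := RInt_beta_bounds a g n0 (le_n n).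
have hn : 0 < INR n by exact: lt_0_INR.
by rewrite (_ : INR n / INR n = 1) in h; [exact: h|field; lra].
Qed.

(** The difference of the upper and the lower sum telescopes, since both factors are
    monotone with values in [0,1]. *)
Lemma lower_sum_ge a g n : (0 < n)%coq_nat -> W a g - 2 / INR n <= lower_sum a g n.
Proof.
move=> n0; have [_ h] := RInt_beta_bounds a g n0 (le_n n).
have hn : 0 < INR n by exact: lt_0_INR.
rewrite (_ : INR n / INR n = 1) in h; last by field; lra.
pose u j := root (INR j / INR n) ^ a; pose v j := root (1 - INR j / INR n) ^ g.
have tele j : (j <= n)%coq_nat -> rsum (fun j => u j.+1 * v j) j - rsum (fun j => u j * v j.+1) j
    <= u j - u O + (v O - v j).
  elim: j => [|j IHj] jn; first by rewrite /=; lra.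
  have {}IHj := IHj ltac:(lia).
  have hj : 0 <= INR j / INR n by apply: Rdiv_le_0_compat => //; exact: pos_INR.
  have hj1 : INR j / INR n <= INR j.+1 / INR n.
    by apply: Rmult_le_compat_r; [apply: Rlt_le; exact: Rinv_0_lt_compat|apply: le_INR; lia].
  have hj2 : INR j.+1 / INR n <= 1.
    by apply: (Rmult_le_reg_r (INR n)) => //; rewrite /Rdiv Rmult_assoc Rinv_l; [rewrite Rmult_1_l Rmult_1_r; apply: le_INR|lra].
  have pw x k : x <= 1 -> 0 <= root x ^ k <= 1.
    move=> hx; split; first by apply: pow_le; exact: root_ge0.
    by rewrite -(pow1 k); apply: pow_incr; split; [exact: root_ge0|exact: root_le1].
  have [u0 u1] : 0 <= u j <= 1 by apply: pw; lra.
  have [v0 v1] : 0 <= v j <= 1 by apply: pw; lra.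
  have uu : u j <= u j.+1.
    by apply: pow_incr; split; [exact: root_ge0|apply: root_mono].
  have vv : v j.+1 <= v j.
    by apply: pow_incr; split; [exact: root_ge0|apply: root_mono; lra].
  rewrite !rsumS.
  have : u j.+1 * v j - u j * v j.+1 <= (u j.+1 - u j) + (v j - v j.+1) by nra.
  lra.
have := tele n (le_n n).
have un : u n = 1 by rewrite /u (_ : INR n / INR n = 1) ?root1 ?pow1 //; field; lra.
have v0 : v O = 1 by rewrite /v (_ : 1 - INR 0 / INR n = 1) ?root1 ?pow1 //; rewrite /=; field; lra.
have u0 : 0 <= u O by apply: pow_le; exact: root_ge0.
have vn : 0 <= v n by apply: pow_le; exact: root_ge0.
rewrite un v0 => t.
have : (rsum (fun j => u j.+1 * v j) n - rsum (fun j => u j * v j.+1) n) / INR n <= 2 / INR n.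
  by apply: Rmult_le_compat_r; [apply: Rlt_le; exact: Rinv_0_lt_compat|lra].
rewrite /W /lower_sum; rewrite -/(u _) -/(v _) in h *.
by rewrite /u /v /Rdiv in h *; lra.
Qed.
End Root.

(** * Strict monotonicity of the growth rate *)

Section Concavity.
Open Scope R_scope.
Variable d' : nat.
Hypothesis d'_gt0 : (0 < d')%coq_nat.
Let d := S d'.
Let d_gt0 : (0 < d)%coq_nat. Proof. by rewrite /d; lia. Qed.
Local Notation W := (W d).
Local Notation W_gt0 := (W_gt0 d_gt0).

Definition quot (a g : nat) := W (S a) g / W a (S g).

Lemma quot_gt0 a g : 0 < quot a g.
Proof. by apply: Rdiv_lt_0_compat; exact: W_gt0. Qed.

Lemma quot_eq a g : W (S a) g = quot a g * W a (S g).
Proof. by have := W_gt0 a (S g); rewrite /quot => h; field; lra. Qed.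

Lemma quot_mono a g : quot a (S g) <= quot (S a) g.
Proof.
have h := W_log_convex d_gt0 a g.
have w1 := W_gt0 a (S (S g)); have w2 := W_gt0 (S a) (S g).
have e1 : quot a (S g) * W a (S (S g)) = W (S a) (S g) by rewrite -quot_eq.
have e2 : quot (S a) g * W (S a) (S g) = W (S (S a)) g by rewrite -quot_eq.
apply: (Rmult_le_reg_r (W a (S (S g)))) => //; apply: (Rmult_le_reg_r (W (S a) (S g))) => //.
rewrite e1; replace (quot (S a) g * W a (S (S g)) * W (S a) (S g))
  with (W a (S (S g)) * (quot (S a) g * W (S a) (S g))) by ring.
by rewrite e2; simpl in h; lra.
Qed.

(** By log-convexity the last quotient of a chain is the largest. *)
Lemma quot_chain n a g T : quot (a + n) g <= T ->
  W (S (a + n)) g <= T ^ (S n) * W a (S (g + n)).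
Proof.
elim: n a g => [|n IHn] a g hT.
  rewrite !addn0 in hT *; rewrite quot_eq pow_1.
  by apply: Rmult_le_compat_r => //; apply: Rlt_le; exact: W_gt0.
have q0 := quot_gt0 (a + S n) g.
rewrite quot_eq; change (T ^ S (S n)) with (T * T ^ S n); rewrite Rmult_assoc.
apply: Rmult_le_compat; [lra|apply: Rlt_le; exact: W_gt0|done|].
rewrite addnS in hT *.
have := IHn a (S g) (Rle_trans _ _ _ (quot_mono _ _) hT).
by rewrite addSn addnS.
Qed.

(** The claim is that this is greater than 1 for a < g, which compares the growth rates
    at (a, g+1) and (a+1, g). *)
Definition ratio (a g : nat) := quot a g ^ d * (INR g + 1) / (INR a + 1).

Lemma INR_d : INR d = INR d' + 1. Proof. exact: S_INR. Qed.

(** A chain of d steps is a shift by d in both indices, which the functional equations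
    evaluate.  The bound tends to 1 as g grows. *)
Lemma ratio_ge a g : (INR g + 1) / (INR g + INR d) <= ratio (a + d') g.
Proof.
have hd : 0 < INR d' by exact: lt_0_INR.
have ha := pos_INR a; have hg := pos_INR g.
have := quot_chain (Rle_refl (quot (a + d') g)).
rewrite -!addnS -/d.
have w := W_gt0 a g; have e1 := W_addl d_gt0 a g; have e2 := W_addr d_gt0 a g.
rewrite /ratio plus_INR; set q := quot _ _ ^ d => h.
rewrite (_ : INR a + INR d' + 1 = INR a + INR d); last by rewrite INR_d; ring.
rewrite INR_d in e1 e2 h *.
have {}h : INR a + (INR d' + 1) <= q * (INR g + (INR d' + 1)).
  apply: (Rmult_le_reg_r (W a g)) => //; rewrite -e1 Rmult_assoc -e2; nra.
apply: (Rmult_le_reg_r (INR g + (INR d' + 1))); first lra.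
apply: (Rmult_le_reg_r (INR a + (INR d' + 1))); first lra.
rewrite /Rdiv Rmult_assoc (Rmult_assoc (INR g + 1)).
replace (/ (INR g + (INR d' + 1)) * ((INR g + (INR d' + 1)) * (INR a + (INR d' + 1))))
  with (INR a + (INR d' + 1)) by (field; lra).
replace (q * (INR g + 1) * / (INR a + (INR d' + 1)) * (INR g + (INR d' + 1)) * (INR a + (INR d' + 1)))
  with (q * (INR g + (INR d' + 1)) * (INR g + 1)) by (field; lra).
by apply: (Rle_trans _ ((INR a + (INR d' + 1)) * (INR g + 1))); [lra|apply: Rmult_le_compat_r; lra].
Qed.

(** When both indices are shifted by d, [ratio] a g gets multiplied by the quotient
    [drift] a / [drift] g. *)
Definition drift (x : nat) :=
  ((INR x + 1 + INR d) / (INR x + INR d)) ^ d * (INR x + 1) / (INR x + 1 + INR d).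

Lemma bernoulli z n : 0 <= z <= 1 -> 1 - INR n * z <= (1 - z) ^ n.
Proof.
move=> hz; elim: n => [|n IHn]; first by rewrite /=; lra.
rewrite S_INR; change ((1 - z) ^ S n) with ((1 - z) * (1 - z) ^ n).
have := pos_INR n; nra.
Qed.

Lemma drift_gt0 x : 0 < drift x.
Proof.
have hd : 0 < INR d by exact: lt_0_INR.
have hx := pos_INR x; apply: Rdiv_lt_0_compat; last lra.
by apply: Rmult_lt_0_compat; [apply: pow_lt; apply: Rdiv_lt_0_compat; lra|lra].
Qed.

(** With y = x+1+d, Bernoulli's inequality reduces the claim to
    (y^2 - d) (y - d + 1) > y (y - d) (y + 1), where the difference is d (d-1). *)
Lemma drift_lt x : drift x < drift (S x).
Proof.
have hd' : 1 <= INR d' by apply: (le_INR 1).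
have hd : INR d = INR d' + 1 := INR_d.
have hx := pos_INR x.
set y := INR x + 1 + INR d; have hy : INR x = y - 1 - INR d by rewrite /y; ring.
have y2 : INR d < y - 1 + / 2 by lra.
have e : drift (S x) = drift x * ((1 - / y ^ 2) ^ d * ((y - INR d + 1) * y / ((y + 1) * (y - INR d)))).
  rewrite /drift S_INR.
  rewrite (_ : INR x + 1 + 1 + INR d = y + 1); last by rewrite /y; ring.
  rewrite (_ : INR x + 1 + INR d = y); last by rewrite /y; ring.
  rewrite (_ : INR x + INR d = y - 1); last by rewrite /y; ring.
  rewrite (_ : (y + 1) / y = y / (y - 1) * (1 - / y ^ 2)); last by field; lra.
  rewrite Rpow_mult_distr hy; field; lra.
rewrite e -{1}(Rmult_1_r (drift x)); apply: Rmult_lt_compat_l; first exact: drift_gt0.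
have hz : 0 <= / y ^ 2 <= 1.
  have hyy : 1 <= y ^ 2 by rewrite /=; nra.
  split; first by apply: Rlt_le; apply: Rinv_0_lt_compat; lra.
  by rewrite -Rinv_1; apply: Rinv_le_contravar; lra.
have hB := bernoulli d hz.
have hpos : 0 < (y - INR d + 1) * y / ((y + 1) * (y - INR d)).
  by apply: Rdiv_lt_0_compat; apply: Rmult_lt_0_compat; lra.
apply: (Rlt_le_trans _ ((1 - INR d * / y ^ 2) * ((y - INR d + 1) * y / ((y + 1) * (y - INR d))))); last first.
  by apply: Rmult_le_compat_r => //; lra.
have -> : (1 - INR d * / y ^ 2) * ((y - INR d + 1) * y / ((y + 1) * (y - INR d))) =
  1 + INR d * (INR d - 1) / (y * (y + 1) * (y - INR d)).
  by field; lra.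
suff : 0 < INR d * (INR d - 1) / (y * (y + 1) * (y - INR d)) by lra.
apply: Rdiv_lt_0_compat; first by apply: Rmult_lt_0_compat; lra.
by apply: Rmult_lt_0_compat; [apply: Rmult_lt_0_compat|]; lra.
Qed.

Lemma drift_lt_trans a n : drift a < drift (a + S n).
Proof.
elim: n => [|n IHn]; first by rewrite addn1; exact: drift_lt.
by rewrite addnS; apply: (Rlt_trans _ _ _ IHn); exact: drift_lt.
Qed.

Lemma quot_shift a g : quot (a + d) (g + d) * ((INR a + INR d) * (INR g + 1 + INR d)) =
  quot a g * ((INR a + 1 + INR d) * (INR g + INR d)).
Proof.
have ha := pos_INR a; have hg := pos_INR g.
have hd : 0 < INR d by exact: lt_0_INR.
have shift p q : W (p + d) (q + d) * ((INR p + INR q + 2 * INR d) * (INR p + INR q + 3 * INR d)) =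
    W p q * ((INR p + INR d) * (INR q + INR d)).
  have e1 := W_addl d_gt0 p (q + d); have e2 := W_addr d_gt0 p q.
  rewrite plus_INR in e1.
  transitivity ((INR p + (INR q + INR d) + 2 * INR d) * W (p + d) (q + d) * (INR p + INR q + 2 * INR d)); first ring.
  rewrite e1; transitivity ((INR p + INR d) * ((INR p + INR q + 2 * INR d) * W p (q + d))); first ring.
  by rewrite e2; ring.
have h1 := shift (S a) g; have h2 := shift a (S g).
rewrite addSn (S_INR a) in h1; rewrite addSn (S_INR g) in h2.
have w1 := W_gt0 (a + d) (S (g + d)); have w2 := W_gt0 a (S g).
have P : 0 < (INR a + 1 + INR g + 2 * INR d) * (INR a + 1 + INR g + 3 * INR d).
  by apply: Rmult_lt_0_compat; lra.
rewrite /quot.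
apply: (Rmult_eq_reg_r ((INR a + 1 + INR g + 2 * INR d) * (INR a + 1 + INR g + 3 * INR d))); last lra.
transitivity ((W (S (a + d)) (g + d) * ((INR a + 1 + INR g + 2 * INR d) * (INR a + 1 + INR g + 3 * INR d)))
  * ((INR a + INR d) * (INR g + 1 + INR d)) / W (a + d) (S (g + d))); first by field; lra.
rewrite h1.
apply: (Rmult_eq_reg_r (W (a + d) (S (g + d)))); last lra.
apply: (Rmult_eq_reg_r (W a (S g))); last lra.
transitivity (W (S a) g * ((INR a + 1 + INR d) * (INR g + INR d)) *
  (W a (S g) * ((INR a + INR d) * (INR g + 1 + INR d)))); first by field; lra.
rewrite -h2.
by field; lra.
Qed.

Lemma ratio_shift a g : ratio (a + d) (g + d) * drift g = ratio a g * drift a.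
Proof.
have ha := pos_INR a; have hg := pos_INR g.
have hd : 0 < INR d by exact: lt_0_INR.
have hq := quot_shift a g.
rewrite /ratio /drift.
have -> : quot (a + d) (g + d) = quot a g * ((INR a + 1 + INR d) / (INR a + INR d)) *
   / ((INR g + 1 + INR d) / (INR g + INR d)).
  apply: (Rmult_eq_reg_r ((INR a + INR d) * (INR g + 1 + INR d))).
    by rewrite hq; field; lra.
  by apply: Rgt_not_eq; apply: Rmult_lt_0_compat; lra.
move: (quot a g) => q.
have : 0 < (INR g + 1 + INR d) / (INR g + INR d) by apply: Rdiv_lt_0_compat; lra.
move: ((INR g + 1 + INR d) / (INR g + INR d)) ((INR a + 1 + INR d) / (INR a + INR d)) => y x y0.
rewrite !Rpow_mult_distr pow_inv !plus_INR.
have := pow_lt _ d y0; move: (y ^ d) (x ^ d) (q ^ d) => Y X Q Y0.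
by field; lra.
Qed.

Lemma ratio_gt0 a g : 0 < ratio a g.
Proof.
have ha := pos_INR a; have hg := pos_INR g.
apply: Rdiv_lt_0_compat; last lra.
by apply: Rmult_lt_0_compat; [apply: pow_lt; exact: quot_gt0|lra].
Qed.

Lemma ratio_shift_lt a n : ratio (a + d) (a + S n + d) < ratio a (a + S n).
Proof.
have e := ratio_shift a (a + S n).
have h1 := drift_gt0 a; have h2 := drift_lt_trans a n; have h3 := ratio_gt0 a (a + S n).
apply: (Rmult_lt_reg_r (drift (a + S n))); first lra.
by rewrite e; apply: Rmult_lt_compat_l.
Qed.

Lemma ratio_shifts_lt a n k : ratio (a + d) (a + S n + d) >= ratio (a + (S k) * d) (a + S n + (S k) * d).
Proof.
elim: k => [|k IHk]; first by rewrite !mul1n; apply: Rle_refl.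
apply: (Rge_trans _ _ _ IHk); apply: Rgt_ge.
have := ratio_shift_lt (a + (S k) * d) n.
have -> : addn (addn a (muln (S k) d)) (S n) = addn (addn a (S n)) (muln (S k) d) by rewrite addnAC.
by rewrite -!addnA -!(mulSnr (S k)).
Qed.

(** Shifting by d makes [ratio] strictly smaller, and in the limit it is at least 1. *)
Lemma ratio_gt1 a n : 1 < ratio a (a + S n).
Proof.
apply: (Rle_lt_trans _ (ratio (a + d) (a + S n + d))); last exact: ratio_shift_lt.
apply: Rnot_lt_le => h; set A := ratio _ _ in h.
have hd : 0 < INR d by exact: lt_0_INR.
have hd' : 0 <= INR d' by exact: pos_INR.
have [k hk] := INR_unbounded (INR d' / (1 - A)).
have hS := ratio_shifts_lt a n k; rewrite -/A in hS.
have := ratio_ge (a + 1 + k * d) (a + S n + (S k) * d).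
rewrite (_ : addn (addn (addn a 1) (muln k d)) d' = addn a (muln (S k) d)); last by rewrite /d; lia.
have hg : (k <= addn (addn a (S n)) (muln (S k) d))%coq_nat by rewrite /d; nia.
move: hg => /le_INR; set g := INR (addn _ _) => hg h1.
have hk0 := pos_INR k.
have {}h1 : (g + 1) / (g + INR d) <= A by apply: (Rle_trans _ _ _ h1); exact: Rge_le.
have h2 : g + 1 <= A * (g + INR d).
  rewrite (_ : g + 1 = (g + 1) / (g + INR d) * (g + INR d)); last by field; lra.
  by apply: Rmult_le_compat_r; lra.
have h3 : INR d' < INR k * (1 - A).
  rewrite (_ : INR d' = INR d' / (1 - A) * (1 - A)); last by field; lra.
  by apply: Rmult_lt_compat_r => //; lra.
rewrite INR_d in h2.
have A0 : 0 < A by exact: ratio_gt0.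
nra.
Qed.

Lemma W_pow_lt a n : (INR a + 1) * W a (S (a + S n)) ^ d < (INR (a + S n) + 1) * W (S a) (a + S n) ^ d.
Proof.
have h := ratio_gt1 a n; have ha := pos_INR a.
have w := W_gt0 a (S (a + S n)).
have w0 : 0 < W a (S (a + S n)) ^ d by exact: pow_lt.
rewrite quot_eq Rpow_mult_distr.
move: h; rewrite /ratio; set q := quot _ _ ^ d => h.
have {}h : INR a + 1 < q * (INR (a + S n) + 1).
  rewrite (_ : q * (INR (a + S n) + 1) = q * (INR (a + S n) + 1) / (INR a + 1) * (INR a + 1)); last by field; lra.
  by rewrite -{1}(Rmult_1_l (INR a + 1)); apply: Rmult_lt_compat_r; lra.
rewrite -Rmult_assoc; apply: Rmult_lt_compat_r => //; lra.
Qed.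

(** The d-th power of the exponential growth rate of the normalized numbers of walks. *)
Definition rate (a g : nat) := W a g ^ d / (INR a`! * INR g`!).

Lemma INR_fact_gt0 n : 0 < INR n`!.
Proof. by apply: lt_0_INR; apply/ltP; exact: fact_gt0. Qed.

Lemma rate_step b g : (b < g)%coq_nat -> rate b (S g) < rate (S b) g.
Proof.
move=> bg; have [k ->] : exists k, g = addn b (S k) by exists (subn g (S b)); lia.
have h := W_pow_lt b k; have hb := pos_INR b; have hc := pos_INR (b + S k).
have f1 := INR_fact_gt0 b; have f2 := INR_fact_gt0 (b + S k).
rewrite /rate !factS !mult_INR (S_INR b) (S_INR (b + S k)).
set X := W b _ ^ d in h *; set Y := W (S b) _ ^ d in h *.
move: (INR b) (INR (b + S k)) (INR b`!) (INR (b + S k)`!) X Y hb hc f1 f2 h => x y p q X Y hb hc f1 f2 h.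
apply: (Rmult_lt_reg_r ((x + 1) * p * ((y + 1) * q))).
  by apply: Rmult_lt_0_compat; apply: Rmult_lt_0_compat; lra.
have -> : X / (p * ((y + 1) * q)) * ((x + 1) * p * ((y + 1) * q)) = (x + 1) * X by field; lra.
have -> : Y / ((x + 1) * p * q) * ((x + 1) * p * ((y + 1) * q)) = (y + 1) * Y by field; lra.
exact: h.
Qed.

Lemma rate_lt a j e : rate a (a + S j + e + S j) < rate (a + S j) (a + S j + e).
Proof.
elim: j a => [|j IHj] a.
  by rewrite !addn1; apply: rate_step; lia.
apply: (Rlt_trans _ (rate (S a) (a + S (S j) + e + S j))).
  by rewrite (addnS _ (S j)); apply: rate_step; lia.
have -> : addn a (S (S j)) = addn (S a) (S j) by lia.
exact: IHj.
Qed.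

End Concavity.

(** * The exponential series *)

Section Exponential.
Open Scope R_scope.

(** [expterm] over the concrete real numbers, for which the analytic lemmas are stated. *)
Definition eterm (x : R) n := x ^ n / INR n`!.

Lemma eterm_ge0 x n : 0 <= x -> 0 <= eterm x n.
Proof.
by move=> x0; apply: Rdiv_le_0_compat; [exact: pow_le|exact: INR_fact_gt0].
Qed.

Lemma rsumD f n m : rsum f (n + m) = rsum f n + rsum (fun i => f (addn n i)) m.
Proof.
by elim: m => [|m IHm]; rewrite ?addn0 ?addnS /= ?Rplus_0_r // IHm Rplus_assoc.
Qed.

Lemma rsum_le f g n : (forall i, (i < n)%coq_nat -> f i <= g i) -> rsum f n <= rsum g n.
Proof.
elim: n => [|n IHn] h; first exact: Rle_refl.
by apply: Rplus_le_compat; [apply: IHn => i hi; apply: h; lia|apply: h; lia].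
Qed.

Lemma rsum_ge0 f n : (forall i, 0 <= f i) -> 0 <= rsum f n.
Proof. by move=> h; elim: n => [|n IHn] /=; [lra|have := h n; lra]. Qed.

Lemma rsum_const c n : rsum (fun=> c) n = INR n * c.
Proof. by elim: n => [|n IHn]; [rewrite /=; lra|rewrite S_INR /= IHn; lra]. Qed.

Lemma rsum_scal c f n : rsum (fun i => c * f i) n = c * rsum f n.
Proof. by elim: n => [|n IHn]; rewrite /= ?IHn; lra. Qed.

Lemma rsum_sum_n f n : rsum f (S n) = sum_n f n.
Proof.
elim: n => [|n IHn]; first by rewrite sum_O /= Rplus_0_l.
by rewrite sum_Sn -IHn.
Qed.

Lemma is_series_exp x : is_series (eterm x) (exp x).
Proof.
apply: (is_series_ext (fun n => scal (pow_n x n) (/ INR (Factorial.fact n)))); last exact: is_exp_Reals.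
move=> n; rewrite /eterm /scal /= /mult /= pow_n_pow.
by congr (_ * / INR _); elim: n => [|n IHn] //; rewrite factS -IHn.
Qed.

Lemma rsum_exp_le x n : 0 <= x -> rsum (eterm x) n <= exp x.
Proof.
move=> x0; have h : is_series (eterm x) (exp x) by exact: is_series_exp.
have hinc k : rsum (eterm x) k <= rsum (eterm x) (S k).
  by have := eterm_ge0 k x0; rewrite /=; lra.
apply: (Rle_trans _ _ _ (hinc n)); rewrite rsum_sum_n.
apply: (is_lim_seq_incr_compare (sum_n (eterm x)) (exp x)); first exact: h.
by move=> k; rewrite -!rsum_sum_n.
Qed.

Lemma exp_le_rsum x : exists n, exp x <= 2 * rsum (eterm x) n.
Proof.
have h : is_lim_seq (sum_n (eterm x)) (exp x) by exact: is_series_exp.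
have e0 := exp_pos x.
have /is_lim_seq_spec /(_ (mkposreal _ (Rmult_lt_0_compat _ _ e0 (Rinv_0_lt_compat 2 ltac:(lra))))) [n hn] := h.
exists (S n); rewrite rsum_sum_n; have := hn n (le_n n) => /= hh.
by have := Rabs_def2 _ _ hh; lra.
Qed.

Lemma rsum_mul f n d : rsum f (n * d) = rsum (fun k => rsum (fun i => f (addn (muln k d) i)) d) n.
Proof. by elim: n => [|n IHn] //; rewrite mulSnr rsumD IHn. Qed.

Lemma rsum_exp_mul_le x d n : 0 <= x -> (0 < d)%coq_nat ->
  rsum (fun k => eterm x (k * d)) n <= exp x.
Proof.
move=> x0 d0; apply: (Rle_trans _ (rsum (eterm x) (n * d))); last exact: rsum_exp_le.
rewrite rsum_mul; apply: rsum_le => k _.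
have -> : d = addn 1 (subn d 1) by lia.
rewrite rsumD /= addn0 Rplus_0_l -{1}(Rplus_0_r (eterm _ _)); apply: Rplus_le_compat_l.
by apply: rsum_ge0 => i; exact: eterm_ge0.
Qed.

(** Only the terms of index divisible by d are kept; each of the d terms that follow
    such a term exceeds it by a factor (1+x)^d at most. *)
Lemma exp_le_rsum_mul x d : 0 <= x -> (0 < d)%coq_nat ->
  exists n, exp x <= 2 * (INR d * (1 + x) ^ d) * rsum (fun k => eterm x (k * d)) n.
Proof.
move=> x0 d0; have [n hn] := exp_le_rsum x; exists n.
apply: (Rle_trans _ _ _ hn); rewrite Rmult_assoc; apply: Rmult_le_compat_l; first lra.
apply: (Rle_trans _ (rsum (eterm x) (n * d))).
  have -> : muln n d = addn n (muln n (subn d 1)) by nia.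
  rewrite rsumD -{1}(Rplus_0_r (rsum _ _)); apply: Rplus_le_compat_l.
  by apply: rsum_ge0 => i; exact: eterm_ge0.
rewrite rsum_mul -rsum_scal; apply: rsum_le => k _.
rewrite Rmult_assoc -rsum_const; apply: rsum_le => i hi.
rewrite /eterm pow_add.
have xi : 0 <= x ^ i <= (1 + x) ^ d.
  split; first exact: pow_le.
  apply: (Rle_trans _ ((1 + x) ^ i)); first by apply: pow_incr; lra.
  by apply: Rle_pow; [lra|lia].
have f1 := INR_fact_gt0 (k * d); have f2 := INR_fact_gt0 (k * d + i).
have fle : / INR (k * d + i)`! <= / INR (k * d)`!.
  apply: Rinv_le_contravar => //; apply: le_INR; apply/leP.
  by apply: leq_fact; rewrite leq_addr.
have xk : 0 <= x ^ (k * d) by exact: pow_le.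
rewrite /Rdiv -Rmult_assoc; apply: Rmult_le_compat.
- by apply: Rmult_le_pos => //; lra.
- by apply: Rlt_le; exact: Rinv_0_lt_compat.
- by rewrite Rmult_comm; apply: Rmult_le_compat_r => //; lra.
- exact: fle.
Qed.

Lemma exp_INR_mul n y : exp (INR n * y) = exp y ^ n.
Proof.
elim: n => [|n IHn]; first by rewrite Rmult_0_l exp_0.
by rewrite S_INR Rmult_plus_distr_r Rmult_1_l exp_plus IHn /= Rmult_comm.
Qed.

(** Compare with (1 + r X)^(Q+1), where r = e / (Q+1). *)
Lemma exp_beats_pow e D Q c : 0 < e -> 0 <= D -> 0 < c ->
  exists X0, forall X, X0 <= X -> 0 <= X -> (D * (1 + X)) ^ Q < c * exp (e * X).
Proof.
move=> e0 D0 c0; pose q := INR Q + 1; have hq : 0 < q by rewrite /q; have := pos_INR Q; lra.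
pose r := e / q; have r0 : 0 < r by exact: Rdiv_lt_0_compat.
have cr : 0 < c * r ^ (S Q) by apply: Rmult_lt_0_compat => //; exact: pow_lt.
exists (Rmax 1 ((2 * D) ^ Q / (c * r ^ (S Q)) + 1)) => X hX X0.
have X1 : 1 <= X by apply: Rle_trans hX; exact: Rmax_l.
have X2 : (2 * D) ^ Q / (c * r ^ (S Q)) + 1 <= X by apply: Rle_trans hX; exact: Rmax_r.
have -> : exp (e * X) = exp (r * X) ^ (S Q).
  rewrite -exp_INR_mul; congr exp; rewrite S_INR /r -/q; field; lra.
apply: (Rle_lt_trans _ ((2 * D) ^ Q * X ^ Q)).
  by rewrite -Rpow_mult_distr; apply: pow_incr; nra.
apply: (Rlt_le_trans _ (c * (r * X) ^ (S Q))); last first.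
  apply: Rmult_le_compat_l; first lra.
  apply: pow_incr; split; first by apply: Rmult_le_pos; lra.
  by have := exp_ineq1_le (r * X); lra.
rewrite (Rpow_mult_distr r X); change (X ^ S Q) with (X * X ^ Q); rewrite -Rmult_assoc -Rmult_assoc.
apply: Rmult_lt_compat_r; first by apply: pow_lt; lra.
rewrite (_ : (2 * D) ^ Q = (2 * D) ^ Q / (c * r ^ (S Q)) * (c * r ^ (S Q))); last by field; split; [apply: pow_nonzero|]; lra.
by rewrite [X in _ < X]Rmult_comm; apply: Rmult_lt_compat_r => //; lra.
Qed.
End Exponential.

(** * Growth of the generating functions of walks *)

Section Transfer.
Import Order.TTheory GRing.Theory Num.Theory.
Local Open Scope ring_scope.

Lemma rsumE (f : nat -> R) n : rsum f n = \sum_(i < n) f i.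
Proof. by elim: n => [|n IHn] /=; rewrite ?big_ord0 // big_ord_recr /= -IHn. Qed.

Fixpoint rprod (f : nat -> R) n : R := if n is n'.+1 then Rmult (rprod f n') (f n') else IZR 1.

Lemma rprodE (f : nat -> R) n : rprod f n = \prod_(i < n) f i.
Proof. by elim: n => [|n IHn] /=; rewrite ?big_ord0 // big_ord_recr /= -IHn. Qed.

Lemma etermE x n : eterm x n = expterm n x.
Proof. by rewrite /eterm /expterm RpowE INRE RdivE. Qed.

Lemma total_walks_le_R a b c N k (A B : R) (U V : nat -> R) :
  Rle 0 A -> Rle 0 B -> (forall x, Rle 0 (U x)) -> (forall x, Rle 0 (V x)) ->
  (forall x y, (x <= y)%coq_nat -> Rle (U x) (U y)) ->
  (forall x y, (x <= y)%coq_nat -> Rle (V y) (V x)) ->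
  (forall x, (x < N)%coq_nat -> Rle (INR 'C(x, a)) (Rmult A (pow (U x) (S b)))) ->
  (forall x, (x < N)%coq_nat -> Rle (INR 'C(N - x.+1, c)) (Rmult B (pow (V x) (S b)))) ->
  Rle (INR (total_walks a b c N k))
    (Rmult (INR N) (Rmult (pow (Rmult A B) k) (eterm (rsum (fun x => Rmult (U x) (V x)) N) (k * b.+1)))).
Proof.
move=> /RleP A0 /RleP B0 U0 V0 hU hV hA hB; apply/RleP.
rewrite etermE rsumE !RealsE.
have h := @total_walks_le R a b c N A B U V A0 B0.
apply: h.
- by move=> x; apply/RleP.
- by move=> x; apply/RleP.
- by move=> x y /ssrnat.leP xy; apply/RleP; apply: hU.
- by move=> x y /ssrnat.leP xy; apply/RleP; apply: hV.
- by move=> x /ssrnat.ltP /hA /RleP; rewrite !RealsE.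
- by move=> x /ssrnat.ltP /hB /RleP; rewrite !RealsE.
Qed.

Lemma total_walks_ge_R a b c L M K t : Rle 0 t ->
  Rle (Rmult (INR 'C(L, c.+1)) (rprod (fun j => rsum (fun l => Rmult (pow t l)
      (INR (expn (block_weight a c L M j) l * 'C(L, l * b.+1)))) K.+1) M))
    (Rmult (pow (INR (M.+1 * L)) c)
      (rsum (fun k => Rmult (pow t k) (INR (total_walks a b c (M.+1 * L) k))) (M * K).+1)).
Proof.
move=> /RleP t0; apply/RleP; rewrite rprodE rsumE !RealsE.
under eq_bigr => j _ do (rewrite rsumE; under eq_bigr => l _ do rewrite !RealsE).
under [X in _ <= _ * X]eq_bigr => k _ do rewrite !RealsE.
exact: total_walks_ge.
Qed.
End Transfer.

Section Growth.
Open Scope R_scope.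

(** Both sides are the l-th power of the same number, divided by f. *)
Lemma block_algebra (a c d l : nat) (s eta k x y n m fa fc f : R) :
  0 < n -> 0 < m -> 0 < fa -> 0 < fc -> 0 < f -> k ^ d = / (fa * fc) ->
  (s * (eta ^ (a + c + d) * k * (x ^ a * y ^ c) / m)) ^ (l * d) / f =
  (s ^ d / n ^ (a + c + d)) ^ l *
  (((eta ^ d) ^ a * (x ^ d * n) ^ a / fa * ((eta ^ d) ^ c * (y ^ d * n) ^ c / fc)) ^ l *
   ((eta ^ d) ^ (l * d) * (n / m) ^ (l * d) / f)).
Proof.
move=> n0 m0 fa0 fc0 f0 hk.
have pw u i j : u ^ (i * j) = (u ^ j) ^ i by rewrite -pow_mult Nat.mul_comm.
have pc (u : R) i j : (u ^ i) ^ j = (u ^ j) ^ i by rewrite -!pow_mult Nat.mul_comm.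
rewrite !pw /Rdiv -!Rmult_assoc; congr (_ * _); rewrite -!Rpow_mult_distr; congr (_ ^ _).
rewrite !pow_add !Rpow_mult_distr hk (pc x a d) (pc y c d).
rewrite (pc eta a d) (pc eta c d) !pow_inv.
have na : 0 < n ^ a by exact: pow_lt.
have nc : 0 < n ^ c by exact: pow_lt.
have nd : 0 < n ^ d by exact: pow_lt.
have md : 0 < m ^ d by exact: pow_lt.
by field; lra.
Qed.

Section Rates.
Variables (a b c : nat).
Let d := S b.
Let q := addn (addn a c) d.
Local Notation F N k := (INR (total_walks a b c N k)).
Let d_gt0 : (0 < d)%coq_nat. Proof. exact: Nat.lt_0_succ. Qed.

(** Chosen so that the d-th power of [growth] below is the rate W^d / (a! c!). *)
Definition kappa := root d (/ (INR a`! * INR c`!)).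

Lemma kappa_inv_pos : 0 < / (INR a`! * INR c`!).
Proof. by apply: Rinv_0_lt_compat; apply: Rmult_lt_0_compat; exact: INR_fact_gt0. Qed.

Lemma kappa_gt0 : 0 < kappa.
Proof. by apply: root_gt0; exact: kappa_inv_pos. Qed.

Lemma kappa_pow : kappa ^ d = / (INR a`! * INR c`!).
Proof. by apply: root_pow => //; apply: Rlt_le; exact: kappa_inv_pos. Qed.

Lemma INR_fact_ge1 n : 1 <= INR n`!.
Proof. by apply: (le_INR 1); apply/ssrnat.leP; exact: fact_gt0. Qed.

Lemma kappa_le1 : kappa <= 1.
Proof.
apply: root_le1 => //; rewrite -Rinv_1; apply: Rinv_le_contravar; first lra.
have := INR_fact_ge1 a; have := INR_fact_ge1 c; nra.
Qed.

Definition growth := kappa * W d a c.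

Lemma growth_gt0 : 0 < growth.
Proof. by apply: Rmult_lt_0_compat; [exact: kappa_gt0|exact: W_gt0]. Qed.

Lemma growth_pow : growth ^ d = W d a c ^ d / (INR a`! * INR c`!).
Proof. by rewrite /growth Rpow_mult_distr kappa_pow Rmult_comm. Qed.

Lemma bin_fact_le n k : INR 'C(n, k) <= INR n ^ k / INR k`!.
Proof.
have f0 := INR_fact_gt0 k; apply: (Rmult_le_reg_r (INR k`!)) => //.
rewrite /Rdiv Rmult_assoc Rinv_l ?Rmult_1_r -?mult_INR; last lra.
rewrite -pow_INR; apply: le_INR; apply/ssrnat.leP.
change (is_true (leq (muln 'C(n, k) k`!) (Nat.pow n k))); rewrite bin_ffact.
elim: k {f0} => [|k IHk]; first by rewrite ffactn0.
by rewrite ffactnSr mulnC; apply: leq_mul => //; exact: leq_subr.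
Qed.

Lemma total_walks_upper N k : (0 < N)%coq_nat ->
  F N k <= INR N * ((INR N ^ (a + c) * kappa ^ d) ^ k * eterm (INR N * W d a c) (k * d)).
Proof.
move=> N0; have hN : 0 < INR N by exact: lt_0_INR.
pose U x := root d (INR x / INR N) ^ a; pose V x := root d (1 - INR (S x) / INR N) ^ c.
have iN : 0 < / INR N by exact: Rinv_0_lt_compat.
have hdiv x y : (x <= y)%coq_nat -> INR x / INR N <= INR y / INR N.
  by move=> xy; apply: Rmult_le_compat_r; [lra|exact: le_INR].
have fa := INR_fact_gt0 a; have fc := INR_fact_gt0 c.
have pN k' : 0 < INR N ^ k' by exact: pow_lt.
have := @total_walks_le_R a b c N k (INR N ^ a / INR a`!) (INR N ^ c / INR c`!) U V.
rewrite -/d => h; apply: (Rle_trans _ _ _ (h _ _ _ _ _ _ _ _)).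
- by apply: Rlt_le; exact: Rdiv_lt_0_compat.
- by apply: Rlt_le; exact: Rdiv_lt_0_compat.
- by move=> x; apply: pow_le; exact: root_ge0.
- by move=> x; apply: pow_le; exact: root_ge0.
- move=> x y xy; apply: pow_incr; split; first exact: root_ge0.
  by apply: root_mono => //; exact: hdiv.
- move=> x y xy; apply: pow_incr; split; first exact: root_ge0.
  by apply: root_mono => //; have := hdiv _ _ (le_n_S _ _ xy); lra.
- move=> x xN; apply: (Rle_trans _ _ _ (bin_fact_le x a)).
  rewrite /U -pow_mult Nat.mul_comm pow_mult root_pow //; last first.
    by apply: Rdiv_le_0_compat => //; exact: pos_INR.
  rewrite /Rdiv Rpow_mult_distr pow_inv; apply: Req_le; have := pN a => pNa; field; lra.
- move=> x xN; apply: (Rle_trans _ _ _ (bin_fact_le _ c)).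
  have hx : INR (N - S x) = INR N * (1 - INR (S x) / INR N).
    by rewrite minus_INR //; field; lra.
  rewrite /V -pow_mult Nat.mul_comm pow_mult root_pow //; last first.
    apply: (Rmult_le_reg_l (INR N)) => //; rewrite -hx Rmult_0_r; exact: pos_INR.
  rewrite hx Rpow_mult_distr; apply: Req_le; field; lra.
rewrite kappa_pow pow_add; apply: Rmult_le_compat_l; first lra.
have -> : INR N ^ a / INR a`! * (INR N ^ c / INR c`!) = INR N ^ a * INR N ^ c * / (INR a`! * INR c`!) by field; lra.
apply: Rmult_le_compat_l.
  by apply: pow_le; apply: Rlt_le; apply: Rmult_lt_0_compat; [apply: Rmult_lt_0_compat|exact: kappa_inv_pos].
apply: Rmult_le_compat_r; first by apply: Rlt_le; apply: Rinv_0_lt_compat; exact: INR_fact_gt0.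
apply: pow_incr; split.
  by apply: rsum_ge0 => x; apply: Rmult_le_pos; apply: pow_le; exact: root_ge0.
have := lower_sum_le d_gt0 a c N0; rewrite /lower_sum => hl.
rewrite -(Rmult_1_r (rsum _ _)) -(Rinv_l (INR N)); last lra.
by rewrite -Rmult_assoc (Rmult_comm (INR N)); apply: Rmult_le_compat_r; [lra|exact: hl].
Qed.

(** A partial sum of the generating function of the normalized numbers of walks, with
    the variable written s^d so that its growth is exponential in s. *)
Definition walk_series s N n :=
  rsum (fun k => s ^ (k * d) * (F N k / INR N ^ S (k * q))) n.

Lemma walk_series_upper s N n : 0 <= s -> (0 < N)%coq_nat ->
  walk_series s N n <= exp (s * growth).
Proof.
move=> s0 N0; have hN : 0 < INR N by exact: lt_0_INR.
apply: (Rle_trans _ (rsum (fun k => eterm (s * growth) (k * d)) n)); last first.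
  by apply: rsum_exp_mul_le => //; apply: Rmult_le_pos => //; apply: Rlt_le; exact: growth_gt0.
apply: rsum_le => k _.
have h := total_walks_upper k N0.
have sk : 0 <= s ^ (k * d) by exact: pow_le.
have pN : 0 < INR N ^ S (k * q) by exact: pow_lt.
have iN : 0 < / INR N ^ S (k * q) by exact: Rinv_0_lt_compat.
apply: (Rle_trans _ (s ^ (k * d) * ((INR N * ((INR N ^ (a + c) * kappa ^ d) ^ k * eterm (INR N * W d a c) (k * d)))
   / INR N ^ S (k * q)))).
  by apply: Rmult_le_compat_l => //; apply: Rmult_le_compat_r => //; lra.
apply: Req_le; rewrite /eterm /growth (Rpow_mult_distr (INR N ^ (a + c))).
rewrite (Rpow_mult_distr (INR N) (W d a c)) (Rpow_mult_distr s) (Rpow_mult_distr kappa (W d a c)).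
have -> : INR N ^ S (k * q) = INR N * (INR N ^ (a + c)) ^ k * INR N ^ (k * d).
  rewrite /q -!pow_mult -[INR N ^ S _]/(INR N * _) Rmult_assoc -pow_add; congr (_ * _ ^ _).
  by lia.
have -> : (kappa ^ d) ^ k = kappa ^ (k * d) by rewrite -pow_mult Nat.mul_comm.
have p1 : 0 < (INR N ^ (a + c)) ^ k by apply: pow_lt; exact: pow_lt.
have p2 : 0 < INR N ^ (k * d) by exact: pow_lt.
have f1 := INR_fact_gt0 (k * d).
by field; lra.
Qed.

(** The contribution of block j, of relative length 1/(M+1), to the growth rate.  The
    factor eta < 1 absorbs the differences between binomial coefficients and powers
    in blocks of finite length. *)
Definition block_rate eta M j :=
  eta ^ q * kappa * (root d (INR j / INR (S M)) ^ a * root d (1 - INR (S j) / INR (S M)) ^ c) / INR (S M).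

(** All n factors of the falling factorial of x are at least theta x. *)
Lemma bin_fact_ge theta n x : 0 <= theta <= 1 -> (x = O \/ INR n <= (1 - theta) * INR x) ->
  theta ^ n * INR x ^ n / INR n`! <= INR 'C(x, n).
Proof.
move=> ht hx; have f0 := INR_fact_gt0 n; apply: (Rmult_le_reg_r (INR n`!)) => //.
rewrite /Rdiv Rmult_assoc Rinv_l ?Rmult_1_r -?mult_INR; last lra.
change (theta ^ n * INR x ^ n <= INR (muln 'C(x, n) n`!)); rewrite bin_ffact -Rpow_mult_distr.
case: hx => [->|hx].
  rewrite /= Rmult_0_r; case: n {f0} => [|n]; first by rewrite ffactn0 /=; lra.
  by rewrite pow_i; [exact: pos_INR|lia].
have x0 := pos_INR x.
suff : forall k, (k <= n)%coq_nat -> (theta * INR x) ^ k <= INR (falling_factorial x k) by apply.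
elim=> [|k IHk] kn; first by rewrite ffactn0 /=; lra.
rewrite ffactnSr mult_INR minus_INR; last first.
  by apply: INR_le; have := le_INR _ _ kn; rewrite S_INR; nra.
change ((theta * INR x) ^ S k) with (theta * INR x * (theta * INR x) ^ k).
rewrite Rmult_comm; apply: Rmult_le_compat.
- by apply: pow_le; nra.
- by nra.
- by apply: IHk; lia.
- by have := le_INR _ _ kn; rewrite S_INR; nra.
Qed.

Lemma INR_expn u k : INR (expn u k) = INR u ^ k.
Proof. by elim: k => [|k IHk] //; rewrite expnS [LHS]mult_INR IHk. Qed.

(** A term of the exponential series at s times the block rate is a lower bound for the
    corresponding term of [total_walks_ge] as soon as the blocks are long. *)
Lemma block_term_ge eta s M L j l : 0 < eta < 1 -> 0 <= s -> (j < M)%coq_nat -> (0 < L)%coq_nat ->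
  INR a <= (1 - eta ^ d) * INR L -> INR c <= (1 - eta ^ d) * INR L ->
  INR (l * d) <= (1 - eta ^ d) * INR L ->
  eterm (s * block_rate eta M j) (l * d) <=
  (s ^ d / INR (S M * L) ^ q) ^ l * INR (expn (block_weight a c L M j) l * 'C(L, l * d)).
Proof.
move=> he s0 jM L0 ha hc hl.
have hL : 0 < INR L by exact: lt_0_INR.
have hM : 0 < INR (S M) by apply: lt_0_INR; lia.
have ht : 0 <= eta ^ d <= 1.
  by split; [apply: pow_le; lra|rewrite -(pow1 d); apply: pow_incr; lra].
have eN : INR (S M * L) = INR (S M) * INR L by rewrite mult_INR.
have hN : 0 < INR (S M * L) by rewrite eN; exact: Rmult_lt_0_compat.
have jS : INR (S j) <= INR M by apply: le_INR.
have jl : INR (S j * L) <= INR (S M * L).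
  by apply: le_INR; nia.
have ma (y z : nat) : y = O \/ (1 <= y)%coq_nat -> INR z <= (1 - eta ^ d) * INR L ->
    muln y L = O \/ INR z <= (1 - eta ^ d) * INR (y * L).
  case=> [->|y1] hz; [by left; rewrite mul0n|right].
  apply: (Rle_trans _ _ _ hz); apply: Rmult_le_compat_l; first lra.
  by apply: le_INR; nia.
have e2 : subn (muln (S M) L) (muln (S j) L) = muln (subn (S M) (S j)) L by rewrite mulnBl.
have h1 : (eta ^ d) ^ a * INR (j * L) ^ a / INR a`! <= INR 'C(j * L, a).
  by apply: bin_fact_ge => //; apply: ma => //; lia.
have h2 : (eta ^ d) ^ c * INR (S M * L - S j * L) ^ c / INR c`! <= INR 'C(S M * L - S j * L, c).
  apply: bin_fact_ge => //; rewrite e2; apply: ma => //; lia.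
have h3 : (eta ^ d) ^ (l * d) * INR L ^ (l * d) / INR (l * d)`! <= INR 'C(L, l * d).
  by apply: bin_fact_ge => //; right.
rewrite (mult_INR (expn _ _)) /block_weight.
have -> : INR (expn (muln 'C(j * L, a) 'C(S M * L - S j * L, c)) l) =
    (INR 'C(j * L, a) * INR 'C(S M * L - S j * L, c)) ^ l.
  by rewrite INR_expn; congr (_ ^ _); exact: mult_INR.
have p1 : 0 <= (eta ^ d) ^ a * INR (j * L) ^ a / INR a`!.
  apply: Rdiv_le_0_compat; last exact: INR_fact_gt0.
  by apply: Rmult_le_pos; apply: pow_le; [lra|exact: pos_INR].
have p2 : 0 <= (eta ^ d) ^ c * INR (S M * L - S j * L) ^ c / INR c`!.
  apply: Rdiv_le_0_compat; last exact: INR_fact_gt0.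
  by apply: Rmult_le_pos; apply: pow_le; [lra|exact: pos_INR].
have p3 : 0 <= (eta ^ d) ^ (l * d) * INR L ^ (l * d) / INR (l * d)`!.
  apply: Rdiv_le_0_compat; last exact: INR_fact_gt0.
  by apply: Rmult_le_pos; apply: pow_le; [lra|exact: pos_INR].
have p4 : 0 <= s ^ d / INR (S M * L) ^ q.
  by apply: Rdiv_le_0_compat; [exact: pow_le|exact: pow_lt].
apply: (Rle_trans _ ((s ^ d / INR (S M * L) ^ q) ^ l *
  (((eta ^ d) ^ a * INR (j * L) ^ a / INR a`! * ((eta ^ d) ^ c * INR (S M * L - S j * L) ^ c / INR c`!)) ^ l *
   ((eta ^ d) ^ (l * d) * INR L ^ (l * d) / INR (l * d)`!)))); last first.
  apply: Rmult_le_compat_l; first exact: pow_le.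
  apply: Rmult_le_compat; [apply: pow_le; exact: Rmult_le_pos|exact: p3| |exact: h3].
  by apply: pow_incr; split; [exact: Rmult_le_pos|apply: Rmult_le_compat].
apply: Req_le; rewrite /eterm /block_rate.
have r1 : root d (INR j / INR (S M)) ^ d = INR j / INR (S M).
  by apply: root_pow => //; apply: Rdiv_le_0_compat => //; exact: pos_INR.
have r2 : root d (1 - INR (S j) / INR (S M)) ^ d = 1 - INR (S j) / INR (S M).
  apply: root_pow => //; apply: (Rmult_le_reg_r (INR (S M))) => //.
  rewrite Rmult_0_l Rmult_minus_distr_r /Rdiv Rmult_assoc Rinv_l; last lra.
  by have := le_INR (S j) (S M) ltac:(lia); lra.
set x := root d _ in r1 *; set y := root d _ in r2 *.
have eL1 : INR (j * L) = x ^ d * INR (S M * L) by rewrite r1 eN mult_INR; field; lra.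
have eL2 : INR (S M * L - S j * L) = y ^ d * INR (S M * L).
  by rewrite r2 minus_INR; [rewrite eN mult_INR; field; lra|nia].
have eL3 : INR L = INR (S M * L) / INR (S M) by rewrite eN; field; lra.
rewrite eL1 eL2 eL3.
move: (INR (S M * L)) (INR (S M)) hN hM => N m hN hM.
apply: block_algebra => //; [exact: INR_fact_gt0|exact: INR_fact_gt0|exact: INR_fact_gt0|].
exact: kappa_pow.
Qed.

Lemma rprod_le f g n : (forall i, (i < n)%coq_nat -> 0 <= f i <= g i) -> 0 <= rprod f n <= rprod g n.
Proof.
elim: n => [|n IHn] h /=; first by lra.
have [h1 h2] := IHn (fun i hi => h i (Nat.lt_lt_succ_r _ _ hi)).
have [h3 h4] := h n (Nat.lt_succ_diag_r n).
by split; [exact: Rmult_le_pos|exact: Rmult_le_compat].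
Qed.

Lemma block_rate_ge0 eta M j : 0 < eta < 1 -> 0 <= block_rate eta M j.
Proof.
move=> he; apply: Rdiv_le_0_compat; last by apply: lt_0_INR; lia.
apply: Rmult_le_pos.
  by apply: Rmult_le_pos; [apply: pow_le; lra|apply: Rlt_le; exact: kappa_gt0].
by apply: Rmult_le_pos; apply: pow_le; exact: root_ge0.
Qed.

(** The contribution of the last block, where the walk ends. *)
Definition block_const eta M := (eta ^ d) ^ S c / INR (S c)`! / INR (S M) ^ S c.

Lemma block_const_gt0 eta M : 0 < eta < 1 -> 0 < block_const eta M.
Proof.
move=> he; apply: Rdiv_lt_0_compat; last by apply: pow_lt; apply: lt_0_INR; exact: Nat.lt_0_succ.
apply: Rdiv_lt_0_compat; last exact: INR_fact_gt0.
by apply: pow_lt; apply: pow_lt; lra.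
Qed.

Lemma walk_seriesE s N n : (0 < N)%coq_nat ->
  INR N ^ c * rsum (fun k => (s ^ d / INR N ^ q) ^ k * F N k) n = INR N ^ S c * walk_series s N n.
Proof.
move=> N0; have hN : 0 < INR N by exact: lt_0_INR.
rewrite /walk_series -!rsum_scal; elim: n => [|n IHn] //; rewrite !rsumS IHn; congr (_ + _).
have e : INR N ^ S (n * q) = INR N * (INR N ^ q) ^ n by rewrite -pow_mult Nat.mul_comm.
have pq : 0 < (INR N ^ q) ^ n by apply: pow_lt; exact: pow_lt.
rewrite e /Rdiv Rpow_mult_distr pow_inv; change (INR N ^ S c) with (INR N * INR N ^ c).
have -> : s ^ (n * d) = (s ^ d) ^ n by rewrite -pow_mult Nat.mul_comm.
by field; lra.
Qed.

Lemma walk_series_lower eta s M K L : 0 < eta < 1 -> 0 <= s -> (0 < L)%coq_nat ->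
  INR (a + c + S (K * d)) <= (1 - eta ^ d) * INR L ->
  block_const eta M *
    rprod (fun j => rsum (fun l => eterm (s * block_rate eta M j) (l * d)) (S K)) M <=
  walk_series s (S M * L) (S (M * K)).
Proof.
move=> he s0 L0 hK.
have hL : 0 < INR L by exact: lt_0_INR.
have hM : 0 < INR (S M) by apply: lt_0_INR; lia.
have N0 : (0 < muln (S M) L)%coq_nat by nia.
have hN : 0 < INR (S M * L) by exact: lt_0_INR.
have ht : 0 <= eta ^ d <= 1.
  by split; [apply: pow_le; lra|rewrite -(pow1 d); apply: pow_incr; lra].
have small n : (n <= addn (addn a c) (S (K * d)))%coq_nat -> INR n <= (1 - eta ^ d) * INR L.
  by move=> /le_INR; lra.
have t0 : 0 <= s ^ d / INR (S M * L) ^ q.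
  by apply: Rdiv_le_0_compat; [exact: pow_le|exact: pow_lt].
have := @total_walks_ge_R a b c L M K (s ^ d / INR (S M * L) ^ q) t0.
rewrite (walk_seriesE _ _ N0) => h.
have hc : (eta ^ d) ^ S c * INR L ^ S c / INR (S c)`! <= INR 'C(L, S c).
  by apply: bin_fact_ge => //; right; apply: small; lia.
have c0 : 0 <= (eta ^ d) ^ S c * INR L ^ S c / INR (S c)`!.
  apply: Rdiv_le_0_compat; last exact: INR_fact_gt0.
  by apply: Rmult_le_pos; apply: pow_le; lra.
have [r0 hr] : 0 <= rprod (fun j => rsum (fun l => eterm (s * block_rate eta M j) (l * d)) (S K)) M <=
    rprod (fun j => rsum (fun l => (s ^ d / INR (S M * L) ^ q) ^ l *
      INR (expn (block_weight a c L M j) l * 'C(L, l * S b))) (S K)) M.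
  apply: rprod_le => j jM; split.
    by apply: rsum_ge0 => l; apply: eterm_ge0; apply: Rmult_le_pos => //; exact: block_rate_ge0.
  apply: rsum_le => l lK; apply: block_term_ge => //; apply: small; try lia.
  have hlk : (muln l d <= muln K d)%coq_nat by nia.
  by lia.
have pN : 0 < INR (S M * L) ^ S c by exact: pow_lt.
apply: (Rmult_le_reg_l (INR (S M * L) ^ S c)) => //; apply: (Rle_trans _ _ _ _ h).
apply: (Rle_trans _ ((eta ^ d) ^ S c * INR L ^ S c / INR (S c)`! *
  rprod (fun j => rsum (fun l => eterm (s * block_rate eta M j) (l * d)) (S K)) M)); last first.
  exact: Rmult_le_compat.
rewrite -Rmult_assoc; apply: Rmult_le_compat_r => //; apply: Req_le.
rewrite /block_const [INR (S M * L)]mult_INR (Rpow_mult_distr (INR (S M))).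
have pM : 0 < INR (S M) ^ S c by exact: pow_lt.
have f0 := INR_fact_gt0 (S c).
by move: (INR (S M) ^ S c) (INR L ^ S c) pM => x y x0; field; lra.
Qed.

Lemma rsum_exp_mono x n k : 0 <= x -> (n <= k)%coq_nat ->
  rsum (fun l => eterm x (l * d)) n <= rsum (fun l => eterm x (l * d)) k.
Proof.
move=> x0 nk; have -> : k = addn n (subn k n) by lia.
rewrite rsumD -{1}(Rplus_0_r (rsum _ n)); apply: Rplus_le_compat_l.
by apply: rsum_ge0 => i; exact: eterm_ge0.
Qed.

Lemma block_rate_le1 eta M j : 0 < eta < 1 -> (j < M)%coq_nat -> block_rate eta M j <= 1.
Proof.
move=> he jM; have hM : 1 <= INR (S M) by apply: (le_INR 1); lia.
have hj : INR j <= INR (S M) by apply: le_INR; lia.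
have hj0 := pos_INR (S j).
have iM : 0 < / INR (S M) by apply: Rinv_0_lt_compat; lra.
have pw x k : x <= 1 -> 0 <= root d x ^ k <= 1.
  move=> hx; split; first by apply: pow_le; exact: root_ge0.
  by rewrite -(pow1 k); apply: pow_incr; split; [exact: root_ge0|exact: root_le1].
have [u0 u1] : 0 <= root d (INR j / INR (S M)) ^ a <= 1.
  apply: pw; apply: (Rmult_le_reg_r (INR (S M))); first lra.
  by rewrite /Rdiv Rmult_assoc Rinv_l; lra.
have [v0 v1] : 0 <= root d (1 - INR (S j) / INR (S M)) ^ c <= 1.
  apply: pw; have : 0 <= INR (S j) / INR (S M) by apply: Rmult_le_pos; lra.
  by lra.
have k0 := kappa_gt0; have k1 := kappa_le1.
have [e0 e1] : 0 <= eta ^ q <= 1.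
  by split; [apply: pow_le; lra|rewrite -(pow1 q); apply: pow_incr; lra].
rewrite /block_rate; move: (root d _ ^ a) (root d _ ^ c) (eta ^ q) u0 u1 v0 v1 e0 e1 => u v e u0 u1 v0 v1 e0 e1.
have h1 : 0 <= e * kappa <= 1 by nra.
have h2 : 0 <= u * v <= 1 by nra.
have h3 : 0 <= e * kappa * (u * v) <= 1 by nra.
have h4 : / INR (S M) <= 1 by rewrite -Rinv_1; apply: Rinv_le_contravar; lra.
rewrite /Rdiv; nra.
Qed.

(** The number of steps allowed in each block tends to infinity; only a polynomial
    factor in s is lost. *)
Lemma exp_le_blocks eta s M : 0 < eta < 1 -> 0 <= s ->
  exists K0, forall K, (K0 <= K)%coq_nat ->
  exp (s * rsum (block_rate eta M) M) <=
  (2 * (INR d * (1 + s) ^ d)) ^ M *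
  rprod (fun j => rsum (fun l => eterm (s * block_rate eta M j) (l * d)) (S K)) M.
Proof.
move=> he s0.
suff : forall n, (n <= M)%coq_nat -> exists K0, forall K, (K0 <= K)%coq_nat ->
  exp (s * rsum (block_rate eta M) n) <= (2 * (INR d * (1 + s) ^ d)) ^ n *
  rprod (fun j => rsum (fun l => eterm (s * block_rate eta M j) (l * d)) (S K)) n by move=> h; exact: h.
have hd : 0 < INR d by exact: lt_0_INR.
have s1 : 0 < (1 + s) ^ d by apply: pow_lt; lra.
have P0 : 0 <= 2 * (INR d * (1 + s) ^ d) by nra.
elim=> [|n IHn] nM; first by exists O => K _; rewrite /= Rmult_0_r exp_0; lra.
have [K1 h1] := IHn ltac:(lia).
have b0 := block_rate_ge0 M n he; have b1 := block_rate_le1 he nM.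
have x0 : 0 <= s * block_rate eta M n by exact: Rmult_le_pos.
have [K2 h2] := exp_le_rsum_mul x0 d_gt0.
exists (Nat.max K1 K2) => K hK.
rewrite rsumS Rmult_plus_distr_l exp_plus.
rewrite -[rprod _ (S n)]/(rprod _ n * rsum _ (S K)).
have {}h1 := h1 K ltac:(lia).
have {}h2 : exp (s * block_rate eta M n) <= 2 * (INR d * (1 + s) ^ d) *
    rsum (fun l => eterm (s * block_rate eta M n) (l * d)) (S K).
  apply: (Rle_trans _ _ _ h2); apply: Rmult_le_compat.
  - have : 0 <= (1 + s * block_rate eta M n) ^ d by apply: pow_le; lra.
    by nra.
  - by apply: rsum_ge0 => i; exact: eterm_ge0.
  - apply: Rmult_le_compat_l; first lra; apply: Rmult_le_compat_l; first lra.
    by apply: pow_incr; nra.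
  - by apply: rsum_exp_mono => //; lia.
change ((2 * (INR d * (1 + s) ^ d)) ^ S n) with ((2 * (INR d * (1 + s) ^ d)) * (2 * (INR d * (1 + s) ^ d)) ^ n).
apply: (Rle_trans _ _ _ (Rmult_le_compat _ _ _ _ _ _ h1 h2)); try (apply: Rlt_le; exact: exp_pos).
by apply: Req_le; ring.
Qed.

(** The block rates add up to a lower Riemann sum without its last term. *)
Lemma sum_block_rate_ge eta M : 0 < eta < 1 ->
  eta ^ q * (growth - kappa * (3 / INR (S M))) <= rsum (block_rate eta M) M.
Proof.
move=> he; have k0 := kappa_gt0.
have hM : 0 < INR (S M) by apply: lt_0_INR; lia.
have := lower_sum_ge d_gt0 a c (Nat.lt_0_succ M); rewrite /lower_sum rsumS => h.
set f := (fun j => _) in h.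
have fM : f M <= 1.
  have pw x k : x <= 1 -> 0 <= root d x ^ k <= 1.
    move=> hx; split; first by apply: pow_le; exact: root_ge0.
    by rewrite -(pow1 k); apply: pow_incr; split; [exact: root_ge0|exact: root_le1].
  have iM : 0 < / INR (S M) by apply: Rinv_0_lt_compat; lra.
  have [u0 u1] : 0 <= root d (INR M / INR (S M)) ^ a <= 1.
    apply: pw; apply: (Rmult_le_reg_r (INR (S M))); first lra.
    by rewrite /Rdiv Rmult_assoc Rinv_l ?Rmult_1_r ?Rmult_1_l; [apply: le_INR; lia|lra].
  have [v0 v1] : 0 <= root d (1 - INR (S M) / INR (S M)) ^ c <= 1.
    apply: pw; have : 0 <= INR (S M) / INR (S M) by apply: Rmult_le_pos; lra.
    by lra.
  by rewrite /f; nra.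
have -> : rsum (block_rate eta M) M = eta ^ q * kappa * (rsum f M / INR (S M)).
  rewrite /Rdiv -Rmult_assoc Rmult_comm -!rsum_scal; apply: Rle_antisym; apply: rsum_le => i _;
    by apply: Req_le; rewrite /block_rate /f /Rdiv; ring.
have h' : W d a c - 3 / INR (S M) <= rsum f M / INR (S M).
  have e1 : (rsum f M + f M) / INR (S M) = rsum f M / INR (S M) + f M / INR (S M) by rewrite /Rdiv; ring.
  have e2 : f M / INR (S M) <= 1 / INR (S M).
    by apply: Rmult_le_compat_r => //; apply: Rlt_le; exact: Rinv_0_lt_compat.
  have e3 : 3 / INR (S M) = 2 / INR (S M) + 1 / INR (S M) by rewrite /Rdiv; ring.
  by rewrite e1 in h; lra.
have e0 : 0 <= eta ^ q by apply: pow_le; lra.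
rewrite Rmult_assoc; apply: Rmult_le_compat_l => //; rewrite /growth -Rmult_minus_distr_l.
by apply: Rmult_le_compat_l; lra.
Qed.

End Rates.

(** * Comparing the growth of two families of walks *)

Section CompareGrowth.
Variables (a b c a' b' c' : nat).
Let d := S b.
Let d' := S b'.
Let q := addn (addn a c) d.
Hypothesis hq : addn (addn a' c') d' = q.
Hypothesis walks_le : forall k, exists C, forall N,
  leq (muln (total_walks a' b' c' N k) N)
    (addn (muln (total_walks a b c N k) N) (muln C (expn N (S (muln k q))))).

(** Both variables are powers of the same t, and after normalization the error terms
    are O(1/N). *)
Lemma walk_series_compare s s' n : 0 <= s -> s ^ d = s' ^ d' ->
  exists2 D, 0 <= D & forall N, (0 < N)%coq_nat ->
    walk_series a' b' c' s' N n <= walk_series a b c s N n + D / INR N.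
Proof.
move=> s0 hs; elim: n => [|n [D D0 hD]].
  by exists 0 => [|N _]; rewrite /walk_series /=; lra.
have [C hC] := walks_le n.
have sn : 0 <= s ^ (n * d) by exact: pow_le.
exists (D + s ^ (n * d) * INR C); first by have := pos_INR C; nra.
move=> N N0; have hN : 0 < INR N by exact: lt_0_INR.
have iN : 0 < / INR N by exact: Rinv_0_lt_compat.
rewrite /walk_series !rsumS -/d -/d' -/q hq.
have := hD N N0; rewrite /walk_series -/d -/d' -/q hq => h.
have -> : s' ^ (n * d') = s ^ (n * d).
  by rewrite (mulnC n d) (mulnC n d') [LHS]pow_mult [RHS]pow_mult hs.
have /ssrnat.leP/le_INR := hC N.
rewrite [INR (addn _ _)]plus_INR ![INR (muln _ _)]mult_INR INR_expn => h2.
set F' := INR (total_walks a' b' c' N n) in h2 *; set F := INR (total_walks a b c N n) in h2 *.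
have h3 : F' / INR N ^ S (n * q) <= F / INR N ^ S (n * q) + INR C / INR N.
  have pN : 0 < INR N ^ S (n * q) by exact: pow_lt.
  move: (INR N ^ S (n * q)) pN h2 => x x0 h2.
  apply: (Rmult_le_reg_r (x * INR N)); first exact: Rmult_lt_0_compat.
  have -> : F' / x * (x * INR N) = F' * INR N by field; lra.
  have -> : (F / x + INR C / INR N) * (x * INR N) = F * INR N + INR C * x by field; lra.
  exact: h2.
have h4 : s ^ (n * d) * (F' / INR N ^ S (n * q)) <= s ^ (n * d) * (F / INR N ^ S (n * q) + INR C / INR N).
  exact: Rmult_le_compat_l.
have -> : (D + s ^ (n * d) * INR C) / INR N = D / INR N + s ^ (n * d) * (INR C / INR N) by rewrite /Rdiv; ring.
lra.
Qed.

(** Lower and upper bound hold for arbitrarily long blocks, while the error tends to 0. *)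
Lemma blocks_le_exp eta s s' M K : 0 < eta < 1 -> 0 <= s -> 0 <= s' -> s ^ d = s' ^ d' ->
  block_const b' c' eta M *
    rprod (fun j => rsum (fun l => eterm (s' * block_rate a' b' c' eta M j) (l * d')) (S K)) M <=
  exp (s * growth a b c).
Proof.
move=> he s0 s'0 hs; apply: Rnot_lt_le; set X := exp _; set Y := _ * _ => hlt.
have [D D0 hD] := walk_series_compare (S (M * K)) s0 hs.
have hed : eta ^ d' < 1.
  by apply: (proj2 (pow_lt_1_compat _ _ _ _)); [lra|rewrite /d'; lia].
have [L1 hL1] := INR_unbounded (INR (a' + c' + S (K * d')) / (1 - eta ^ d')).
have [L2 hL2] := INR_unbounded (D / (Y - X)).
pose L := S (L1 + L2).
have L1L : INR L1 <= INR L by apply: le_INR; rewrite /L; lia.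
have L0 : (0 < L)%coq_nat by rewrite /L; lia.
have hN0 : (0 < muln (S M) L)%coq_nat by nia.
have hN : 0 < INR (S M * L) by exact: lt_0_INR.
have hL : INR (a' + c' + S (K * d')) <= (1 - eta ^ d') * INR L.
  have -> : INR (a' + c' + S (K * d')) = (1 - eta ^ d') * (INR (a' + c' + S (K * d')) / (1 - eta ^ d')) by field; lra.
  by apply: Rmult_le_compat_l; lra.
have h1 := @walk_series_lower a' b' c' eta s' M K L he s'0 L0 hL.
have h2 := hD _ hN0.
have h3 := walk_series_upper a b c (S (M * K)) s0 hN0.
have h4 : D / INR (S M * L) < Y - X.
  have L2N : INR L2 <= INR (S M * L) by apply: le_INR; rewrite /L; nia.
  apply: (Rmult_lt_reg_r (INR (S M * L))) => //.
  rewrite /Rdiv Rmult_assoc Rinv_l ?Rmult_1_r; last lra.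
  have -> : D = (Y - X) * (D / (Y - X)) by field; lra.
  by apply: Rmult_lt_compat_l; lra.
have h1' : Y <= walk_series a' b' c' s' (S M * L) (S (M * K)) by exact: h1.
have h3' : walk_series a b c s (S M * L) (S (M * K)) <= X by exact: h3.
lra.
Qed.

(** M is chosen so that the block rates add up to more than the midpoint of lam and the
    growth rate when eta = 1, and then eta so close to 1 that lam is still exceeded. *)
Lemma growth_bound lam : 0 <= lam < growth a' b' c' ->
  exists c0 D Q, [/\ 0 < c0, 0 <= D & forall s s', 0 <= s -> 0 <= s' -> s ^ d = s' ^ d' ->
    c0 * exp (s' * lam) <= (D * (1 + s')) ^ Q * exp (s * growth a b c)].
Proof.
move=> hlam; set G := growth a' b' c' in hlam.
have k0 := kappa_gt0 a' b' c'.
have [M hM] := INR_unbounded (6 * kappa a' b' c' / (G - lam)).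
pose mid := (lam + G) / 2.
have hMS : 0 < INR (S M) by apply: lt_0_INR; lia.
have h1 : mid <= G - kappa a' b' c' * (3 / INR (S M)).
  suff : kappa a' b' c' * (3 / INR (S M)) <= (G - lam) / 2 by rewrite /mid; lra.
  apply: (Rmult_le_reg_r (2 * INR (S M))); first lra.
  have -> : kappa a' b' c' * (3 / INR (S M)) * (2 * INR (S M)) = 6 * kappa a' b' c' by field; lra.
  have -> : (G - lam) / 2 * (2 * INR (S M)) = (G - lam) * INR (S M) by field.
  have -> : 6 * kappa a' b' c' = (G - lam) * (6 * kappa a' b' c' / (G - lam)) by field; lra.
  by apply: Rmult_le_compat_l; [lra|rewrite S_INR; lra].
have m0 : 0 < mid by rewrite /mid; lra.
pose eps := (mid - lam) / (mid * (INR q + 1)).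
have q0 := pos_INR q.
have q1 : 1 <= INR q by apply: (le_INR 1); rewrite /q /d; lia.
have eps0 : 0 < eps.
  by apply: Rdiv_lt_0_compat; [rewrite /mid; lra|apply: Rmult_lt_0_compat; lra].
have eps1 : eps * (INR q + 1) <= 1.
  have -> : eps * (INR q + 1) = (mid - lam) / mid by rewrite /eps; field; lra.
  apply: (Rmult_le_reg_r mid) => //.
  by rewrite /Rdiv Rmult_assoc Rinv_l; lra.
have e1 : eps < 1 by nra.
pose eta := 1 - eps.
have he : 0 < eta < 1 by rewrite /eta; lra.
have h2 : lam <= eta ^ q * mid.
  have := @bernoulli eps q ltac:(lra); rewrite -/eta => hb.
  apply: (Rle_trans _ ((1 - INR q * eps) * mid)); last first.
    by apply: Rmult_le_compat_r; lra.
  have : eps * (INR q + 1) * mid = mid - lam by rewrite /eps; field; lra.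
  have := Rmult_lt_0_compat _ _ eps0 m0; lra.
have h3 : lam <= rsum (block_rate a' b' c' eta M) M.
  have := sum_block_rate_ge a' b' c' M he; rewrite -/d' hq -/G => h.
  apply: (Rle_trans _ _ _ h2); apply: Rle_trans h.
  by apply: Rmult_le_compat_l => //; apply: pow_le; lra.
exists (block_const b' c' eta M), (2 * INR d'), (muln d' M).
have hd' : 1 <= INR d' by apply: (le_INR 1); rewrite /d'; lia.
have c0 := @block_const_gt0 b' c' eta M he.
split=> // [|s s' s0 s'0 hs]; first lra.
have [K hK] := @exp_le_blocks a' b' c' eta s' M he s'0.
have {}hK := hK K (le_n K).
have h4 := @blocks_le_exp eta s s' M K he s0 s'0 hs.
move: h4 hK; rewrite -/d'; set P := rprod _ _ => h4 hK.
have h5 : exp (s' * lam) <= exp (s' * rsum (block_rate a' b' c' eta M) M).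
  have : s' * lam <= s' * rsum (block_rate a' b' c' eta M) M by exact: Rmult_le_compat_l.
  by case=> [h|->]; [apply: Rlt_le; exact: exp_increasing|exact: Rle_refl].
have B0 : 0 <= 2 * (INR d' * (1 + s') ^ d').
  have h0 : 0 <= (1 + s') ^ d' by apply: pow_le; lra.
  by nra.
have h6 : (2 * (INR d' * (1 + s') ^ d')) ^ M <= (2 * INR d' * (1 + s')) ^ (d' * M).
  rewrite pow_mult; apply: pow_incr; split => //.
  rewrite (Rpow_mult_distr (2 * INR d')) -Rmult_assoc; apply: Rmult_le_compat_r.
    by apply: pow_le; lra.
  rewrite -{1}(pow_1 (2 * INR d')); apply: Rle_pow; [lra|rewrite /d'; lia].
have BM : 0 <= (2 * (INR d' * (1 + s') ^ d')) ^ M by exact: pow_le.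
apply: (Rle_trans _ ((2 * (INR d' * (1 + s') ^ d')) ^ M * exp (s * growth a b c))); last first.
  by apply: Rmult_le_compat_r => //; apply: Rlt_le; exact: exp_pos.
apply: (Rle_trans _ (block_const b' c' eta M * ((2 * (INR d' * (1 + s') ^ d')) ^ M * P))).
  by apply: Rmult_le_compat_l; lra.
have -> : block_const b' c' eta M * ((2 * (INR d' * (1 + s') ^ d')) ^ M * P) =
  (2 * (INR d' * (1 + s') ^ d')) ^ M * (block_const b' c' eta M * P) by ring.
exact: Rmult_le_compat_l.
Qed.

Lemma growth_le : d = d' -> growth a' b' c' <= growth a b c.
Proof.
move=> dd; apply: Rnot_lt_le => hlt; have g0 := growth_gt0 a b c.
set g := growth a b c in hlt g0; set G := growth a' b' c' in hlt.
have hlam : 0 <= (g + G) / 2 < G by lra.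
have [c0 [D [Q [c00 D0 h]]]] := growth_bound hlam.
have [X0 hX0] := @exp_beats_pow ((G - g) / 2) D Q c0 ltac:(lra) D0 c00.
pose X := Rmax 0 X0.
have X1 : 0 <= X := Rmax_l _ _; have X2 : X0 <= X := Rmax_r _ _.
have := hX0 X X2 X1; have := h X X X1 X1; rewrite -/g dd => /(_ erefl).
have -> : X * ((g + G) / 2) = (G - g) / 2 * X + X * g by field.
rewrite exp_plus -Rmult_assoc => h1 h2.
have := Rmult_le_reg_r _ _ _ (exp_pos (X * g)) h1; lra.
Qed.

(** With t = s^(d d'), one side grows like the exponential of a multiple of s^d and the
    other at most like that of a multiple of s^d', up to polynomial factors. *)
Lemma growth_order : (d <= d')%coq_nat.
Proof.
case: (Compare_dec.le_gt_dec d d') => // dd; exfalso.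
have g0 := growth_gt0 a b c; have G0 := growth_gt0 a' b' c'.
set g := growth a b c in g0; set G := growth a' b' c' in G0.
have hlam : 0 <= G / 2 < G by lra.
have [c0 [D [Q [c00 D0 h]]]] := growth_bound hlam.
have [X0 hX0] := @exp_beats_pow (G / 4) D Q c0 ltac:(lra) D0 c00.
pose s := 1 + Rabs X0 + 4 * g / G.
have q0 : 0 < 4 * g / G by apply: Rdiv_lt_0_compat; lra.
have a0 := Rabs_pos X0; have a1 := Rle_abs X0.
have s1 : 1 <= s by rewrite /s; lra.
have sd : s <= s ^ d by rewrite -{1}(pow_1 s); apply: Rle_pow; rewrite /d; [lra|lia].
have sdd : s * s ^ d' <= s ^ d by change (s ^ S d' <= s ^ d); apply: Rle_pow; [lra|lia].
have sd' : 1 <= s ^ d' by apply: pow_R1_Rle.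
have e : (s ^ d') ^ d = (s ^ d) ^ d' by rewrite -!pow_mult Nat.mul_comm.
have := h (s ^ d') (s ^ d) ltac:(lra) ltac:(lra) e; rewrite -/g.
have := hX0 (s ^ d) ltac:(rewrite /s in sd *; lra) ltac:(lra).
have hle : s ^ d' * g <= s ^ d * (G / 4).
  have -> : g = G / 4 * (4 * g / G) by field; lra.
  apply: (Rle_trans _ (s ^ d' * (G / 4 * s))); last by nra.
  by apply: Rmult_le_compat_l; [lra|apply: Rmult_le_compat_l; rewrite /s; lra].
have hexp : exp (s ^ d' * g) <= exp (s ^ d * (G / 4)).
  by case: hle => [h'|->]; [apply: Rlt_le; exact: exp_increasing|exact: Rle_refl].
have -> : s ^ d * (G / 2) = G / 4 * s ^ d + s ^ d * (G / 4) by field.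
rewrite exp_plus -Rmult_assoc; set P := (D * _) ^ Q => h1 h2.
have P0 : 0 <= P by apply: pow_le; apply: Rmult_le_pos; lra.
have h3 : P * exp (s ^ d' * g) <= P * exp (s ^ d * (G / 4)) by exact: Rmult_le_compat_l.
have := Rmult_le_reg_r _ _ _ (exp_pos (s ^ d * (G / 4))) (Rle_trans _ _ _ h2 h3); lra.
Qed.

End CompareGrowth.
End Growth.

(** * Recovering the end letters *)

Section Conclusion.
Local Open Scope nat_scope.

(** If a < a', then a' <= c' puts the pair (a', c') strictly between a and c, so its
    walks grow strictly faster with their length for b > 0, and for b = 0 it has
    strictly fewer chains of two windows. *)
Lemma end_letters_le (a b c a' c' : nat) : a + c = a' + c' -> a' <= c' ->
  (forall k, exists C, forall N,
    leq (muln (total_walks a b c N k) N)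
      (addn (muln (total_walks a' b c' N k) N) (muln C (expn N (S (muln k (addn (addn a c) (S b)))))))) ->
  (forall k, exists C, forall N,
    leq (muln (total_walks a' b c' N k) N)
      (addn (muln (total_walks a b c N k) N) (muln C (expn N (S (muln k (addn (addn a c) (S b)))))))) ->
  leq a' a.
Proof.
move=> hac ac' h1 h2; rewrite leqNgt; apply/negP => aa'.
have [j [e [ha' [hc' hc]]]] : exists j e, [/\ a' = addn a j.+1, c' = addn (addn a j.+1) e &
    c = addn (addn (addn a j.+1) e) j.+1].
  by exists (a' - a).-1, (c' - a'); split; lia.
case: b h1 h2 => [|b] h1 h2.
  have [C hC] := h1 2.
  have := @two_windows_le a' c' a c C (esym hac).
  have -> : (a' + c').*2.+3 = S (muln 2 (addn (addn a c) 1)) by lia.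
  move=> /(_ hC); rewrite leqNgt ha' hc' hc => /negP; apply; exact: two_windows_lt.
have hq : addn (addn a' c') (S (S b)) = addn (addn a c) (S (S b)) by rewrite hac.
have hle := growth_le hq h2 erefl.
have := @rate_lt b.+1 (Nat.lt_0_succ b) a j e.
rewrite -hc -hc' -ha' /rate -(growth_pow a b.+1 c) -(growth_pow a' b.+1 c').
apply: Rle_not_lt; apply: pow_incr; split=> //.
by apply: Rlt_le; exact: growth_gt0.
Qed.

End Conclusion.

Open Scope nat_scope.

Theorem theorem1p1 (m : nat) (p t : 'S_m)
  (hp_no : non_overlapping p) (ht_no : non_overlapping t)
  (hp_std : standard p) (ht_std : standard t)
  (hpt : cWilf_equivalent p t) :
  (entry p 1, entry p m) = (entry t 1, entry t m).
Proof.
have htp : cWilf_equivalent t p by move=> n; rewrite hpt.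
have [a [b [c [hm ac m1 [p1 pm -> ->]]]]] := standard_parameters hp_std.
have [a' [b' [c' [hm' ac' _ [t1 tm -> ->]]]]] := standard_parameters ht_std.
have q1 : m.-1 = a + c + b.+1 by lia.
have q2 : m.-1 = a' + c' + b'.+1 by lia.
have hpt_walks k := walks_asymptotics k hp_no ht_no hpt m1 hm hm' p1 pm t1 tm.
have htp_walks k := walks_asymptotics k ht_no hp_no htp m1 hm' hm t1 tm p1 pm.
rewrite q1 in hpt_walks htp_walks.
have q12 : a + c + b.+1 = a' + c' + b'.+1 by lia.
have b1 := growth_order (esym q12) htp_walks.
have b2 : (b'.+1 <= b.+1)%coq_nat.
  apply: (@growth_order a' b' c' a b c q12) => k.
  by have [C hC] := hpt_walks k; exists C => N; rewrite -q12; exact: hC.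
have eb : b' = b by lia.
rewrite eb in hpt_walks htp_walks q12 *.
have hac : a + c = a' + c' by lia.
have h1 := end_letters_le hac ac' hpt_walks htp_walks.
have h2 : a <= a'.
  apply: (end_letters_le (esym hac) ac) => k.
    by have [C hC] := htp_walks k; exists C => N; rewrite -hac; exact: hC.
  by have [C hC] := hpt_walks k; exists C => N; rewrite -hac; exact: hC.
have -> : a' = a by apply/eqP; rewrite eqn_leq h1 h2.
by [].
Qed.
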